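(* Let $I=[0,1]$ and $\mathbb{R}_+=[0,\infty)$. Assume: - $k_1,k_2:I^2\to\mathbb{R}_+$ are continuous; - there exist an interval $[a,b]\subset I$, a function $\Phi_1:I\to\mathbb{R}_+$, $\Phi_1\in L^1(I)$, and a constant $c_1\in(0,1]$ such that $k_1(t,s)\le\Phi_1(s)$ for all $t,s\in I$ and $c_1\Phi_1(s)\le k_1(t,s)$ for all $t\in[a,b]$, $s\in I$; - there exist a function $\Phi_2:I\to\mathbb{R}_+$, $\Phi_2\in L^1(I)$, and a constant $c_2\in(0,1]$ such that $c_2\Phi_2(s)\le k_2(t,s)\le\Phi_2(s)$ for all $t,s\in I$; - $f:I\times\mathbb{R}_+\times\mathbb{R}\to\mathbb{R}_+$ and $g:I\times\mathbb{R}_+\times\mathbb{R}\to\mathbb{R}$ are continuous. Suppose that there exist $\rho_1,\rho_2>0$ and $R_2>0$ such that either (Case A) $\rho_1/c_1<\rho_2$, or (Case B) $\rho_2<\rho_1$, and such that: (i) there is a continuous function $f_*:I\to\mathbb{R}_+$ with $f_*(t)\le f(t,u,v)$ on $[a,b]\times[\rho_1,\rho_1/c_1]\times[-R_2,R_2]$ and $\min_{t\in[a,b]}\int_a^b k_1(t,s)f_*(s)\,ds\ge\rho_1$; (ii) there is a continuous function $f^*:I\to\mathbb{R}_+$ with $f(t,u,v)\le f^*(t)$ on $[0,1]\times[0,\rho_2]\times[-R_2,R_2]$ and $\max_{t\in[0,1]}\int_0^1 k_1(t,s)f^*(s)\,ds\le\rho_2$; (iii) there is a continuous function $g^*:I\to\mathbb{R}_+$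 with $|g(t,u,v)|\le g^*(t)$ on $[0,1]\times[0,R_1]\times[-R_2,R_2]$, where $R_1:=\max\{\rho_1/c_1,\rho_2\}$, and $\max_{t\in[0,1]}\int_0^1 k_2(t,s)g^*(s)\,ds\le R_2$. Then the system $$u(t)=\int_0^1 k_1(t,s)f(s,u(s),v(s))\,ds,\qquad v(t)=\int_0^1 k_2(t,s)g(s,u(s),v(s))\,ds,\qquad t\in I,$$ has at least one non-trivial solution $(u,v)\in K_1\times\mathcal{C}(I)$ such that $\|v\|_\infty\le R_2$ and, in Case A, $\rho_1\le\min_{t\in[a,b]}u(t)$ and $\|u\|_\infty\le\rho_2$ (respectively, in Case B, $\rho_2\le\|u\|_\infty$ and $\min_{t\in[a,b]}u(t)\le\rho_1$).
   Context: $\mathcal{C}(I)$ is the Banach space of continuous real functions on $I=[0,1]$ with $\|w\|_\infty=\max_{t\in I}|w(t)|$. The cone $K_1$ is $$K_1=\{w\in\mathcal{C}(I): w(t)\ge0\ \text{for all }t\in I,\ \min_{t\in[a,b]}w(t)\ge c_1\|w\|_\infty\}.$$ Non-trivial means $(u,v)\ne(0,0)$. *)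

(* Defs.v *)
From HB Require Import structures.
From mathcomp Require Import all_boot all_order all_algebra.
From mathcomp Require Import all_classical all_reals all_analysis.
Import Order.TTheory GRing.Theory Num.Theory.
Import numFieldNormedType.Exports.

Set Implicit Arguments.
Unset Strict Implicit.
Unset Printing Implicit Defensive.

Local Open Scope classical_set_scope.
Local Open Scope ring_scope.

(** Functions on a subset of R (resp. R^2, R^3) are total functions of which
    only the restriction to that subset is ever constrained. *)

Definition unitI (R : realType) : set R := `[0, 1]%classic.

Arguments unitI {R}.

(** Below, [min_on] and [max_on] are only applied to functions that are
    continuous on a nonempty compact set, for which the infimum and the
    supremum are attained. *)
Definition min_on (R : realType) (A : set R) (w : R -> R) : R := inf (w @` A).

Definition max_on (R : realType) (A : set R) (w : R -> R) : R := sup (w @` A).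

Definition CI (R : realType) : set (R -> R) :=
  [set w | {within unitI, continuous w}].

Arguments CI {R}.

Definition normI (R : realType) (w : R -> R) : R :=
  max_on unitI (fun t => `|w t|).

Definition K1 (R : realType) (a b c1 : R) : set (R -> R) :=
  [set w | [/\ CI w,
               (forall t, t \in `[0, 1]%R -> 0 <= w t)
             & min_on `[a, b]%classic w >= c1 * normI w]].

(** Integrability is with respect to the completed Lebesgue measure, so that
    Lebesgue-measurable functions are allowed and not only the Borel ones. *)
Definition L1I (R : realType) (phi : R -> R) : Prop :=
  (@completed_lebesgue_measure R).-integrable unitI (EFin \o phi).

(* Main.v *)
(** Both cases are reduced to a fixed point theorem for self-maps of a compact
    convex set of pairs of functions, by replacing the operator by one which
    maps such a set into itself.  In Case A the first component is precomposed
    with the retraction [u |-> u + (rho1 - min u)^+] of the cone.  In Case B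
    the operator is read in polar coordinates, where the set
    [rho2 <= max u, min u <= rho1] is a cylinder over a convex set, and its
    radial component is reversed; hypotheses (i) and (ii) prevent the fixed
    points from being spurious.

    The fixed point theorem (Tychonoff's, in a power of the real line) comes
    from Brouwer's theorem by Ky Fan's minimax argument and compactness.
    Brouwer's theorem comes from Sperner's lemma for Kuhn's triangulation of
    the cube: the determinant over [F_2] of the one-hot matrix of the labels
    of a simplex is 1 exactly on fully labelled simplices, and expanding it
    over the facets makes the sum over all simplices of a torus telescope. *)

Require Import Defs.
From HB Require Import structures.
From mathcomp Require Import all_boot all_order all_algebra all_fingroup.
From mathcomp Require Import zify ring lra.
From mathcomp Require Import all_classical all_reals all_analysis.
Import Order.TTheory GRing.Theory Num.Theory.
Import numFieldNormedType.Exports.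

Set Implicit Arguments.
Unset Strict Implicit.
Unset Printing Implicit Defensive.

Local Open Scope classical_set_scope.
Local Open Scope ring_scope.

(** * Sperner's lemma *)

(** The obstacle in Case A is that the natural region is convex but not invariant: (i) controls the
    operator only where [u] stays between [rho1] and [rho1 / c] on [[a, b]], not wherever its
    minimum exceeds [rho1]. Retracting by a constant shift lands on minimum exactly [rho1] whenever
    the minimum was too small, and the cone then confines [u] to precisely that range. In Case B the
    region is not convex, and the operator points out of it at both ends of each ray: it lowers the
    maximum where that is [rho2] and raises the minimum where that is [rho1]. Moving the radius
    against the operator turns both ends into inward-pointing ones without changing the genuine
    fixed points.

    The topology throughout is pointwise convergence. Bounded closed sets are compact for it, and a
    modulus of continuity common to all functions upgrades it to uniform convergence, for which the
    integral operators are continuous. *)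

Section Sperner.
Variables (m D : nat).
Local Notation n := m.+1.
Local Notation grid := {ffun 'I_n -> 'I_D.+4}.
Implicit Types (x : grid) (r : 'S_n) (l : grid -> 'I_n.+1).

(* Coordinates are added in the cyclic group ['I_D.+4]: as [x] and [r] vary,
   the simplices triangulate a torus. *)
Definition kuhn_vertex x r (j : nat) : grid :=
  [ffun k => x k + (r k < j)%N%:R].

Definition label_mx l x r : 'M['F_2]_n.+1 :=
  \matrix_(i, j) (l (kuhn_vertex x r i) == j)%:R.

(** Its determinant is 1 exactly when the facet opposite to vertex [i] carries every label except
    [ord_max]. *)
Definition facet_mx l x r (i : 'I_n.+1) : 'M['F_2]_n :=
  row' i (col' ord_max (label_mx l x r)).

Lemma addrr_F2 (y : 'F_2) : y + y = 0.
Proof. by apply: addrr_pchar2; apply: pchar_Fp. Qed.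

Lemma oppr_F2 (y : 'F_2) : - y = y.
Proof. by apply: oppr_pchar2; apply: pchar_Fp. Qed.

(** Every row of the one-hot matrix sums to 1, so adding all columns to the last one (the product
    with [U]) fills it with ones. The cofactor expansion along that column has no signs in
    characteristic 2. *)
Lemma det_label_mx l x r :
  \det (label_mx l x r) = \sum_i \det (facet_mx l x r i).
Proof.
pose U : 'M['F_2]_n.+1 := \matrix_(i, j) ((i == j) || (j == ord_max))%:R.
have detU : \det U = 1.
  rewrite -det_tr det_trig ?big1 //.
    by move=> i _; rewrite !mxE eqxx.
  apply/is_trig_mxP => i j ij; rewrite !mxE.
  have -> : (j == i) = false by apply/negbTE; rewrite -val_eqE /=; lia.
  by rewrite -val_eqE /=; case: eqP => //; have := ltn_ord j; lia.
pose M' := label_mx l x r *m U.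
have M'E i j : j != ord_max -> M' i j = label_mx l x r i j.
  move=> jm; rewrite !mxE (bigD1 j) //= big1 ?addr0.
    by rewrite !mxE eqxx mulr1.
  by move=> k kj; rewrite !mxE (negbTE kj) (negbTE jm) mulr0.
have M'max i : M' i ord_max = 1.
  rewrite !mxE (bigD1 (l (kuhn_vertex x r i))) //= big1 ?addr0.
    by rewrite !mxE !eqxx orbT mulr1.
  by move=> k kj; rewrite !mxE eq_sym (negbTE kj) mul0r.
have -> : \det (label_mx l x r) = \det M' by rewrite det_mulmx detU mulr1.
rewrite (expand_det_col M' ord_max); apply: eq_bigr => i _.
rewrite M'max mul1r /cofactor.
have -> : (-1) ^+ (i + (ord_max : 'I_n.+1)) = 1 :> 'F_2.
  by rewrite oppr_F2 expr1n.
rewrite mul1r; congr (\det _); apply/matrixP => p q.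
by rewrite 2!mxE M'E ?(eq_sym _ ord_max) ?neq_lift // !mxE.
Qed.

(** Swapping the values [i.-1] and [i] of [r] moves vertex [i] only. The two simplices share the
    facet, and since the swap changes parity, even and odd permutations cancel in pairs. *)
Lemma sum_facet_inner l x (i : 'I_n.+1) : (0 < i < n)%N ->
  \sum_r \det (facet_mx l x r i) = 0.
Proof.
move=> /andP[i0 im].
have im1 : (i.-1 < n)%N by lia.
pose p := Ordinal im1; pose q := Ordinal im.
have pq : p != q by rewrite -val_eqE /=; lia.
pose t := tperm p q.
rewrite (bigID (fun r : 'S_n => odd_perm r)) /=.
rewrite [X in _ + X](reindex_inj (mulIg t)) /=.
rewrite [X in _ + X](eq_big (fun r : 'S_n => odd_perm r)
  (fun r => \det (facet_mx l x r i))).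
- exact: addrr_F2.
- by move=> r; rewrite odd_permM odd_tperm pq addbT negbK.
- move=> r _; congr (\det _); apply/matrixP => k s; rewrite !mxE.
  congr ((l _ == _)%:R); apply/ffunP => u; rewrite !ffunE; congr (_ + _%:R).
  rewrite permM /t.
  have : (lift i k : nat) != i by rewrite eq_sym; exact: neq_lift.
  by case: tpermP => [->|->|//] /=; lia.
Qed.

Definition rot_perm : 'S_n := perm (@addrI _ (- Zp1 : 'I_n)).

Lemma val_rot_perm (k : 'I_n) : (rot_perm k : nat) = if k == 0 then m else k.-1.
Proof.
rewrite permE /= modnDml.
have km := ltn_ord k.
case: eqP => [->|k0] /=.
  case: (m) => //= m'. rewrite addn0.
  rewrite [(1 %% _)%N]modn_small // subn1 /= modn_small //.
have k1 : (0 < k)%N by rewrite lt0n; apply/eqP => k0'; apply: k0; apply/val_inj.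
case: m k km k0 k1 => [|m'] k km k0 k1; first by lia.
rewrite [(1 %% _)%N]modn_small // subn1 /=.
have -> : (m'.+1 + k = k.-1 + m'.+2)%N by lia.
by rewrite modnDr modn_small //; lia.
Qed.

(* The facet of [(x, r)] opposite to its first vertex is the facet opposite to
   the last vertex of the simplex based at the second vertex of [(x, r)]. *)
Lemma sum_facet_ends l :
  \sum_x \sum_r \det (facet_mx l x r ord0) =
  \sum_x \sum_r \det (facet_mx l x r ord_max).
Proof.
rewrite exchange_big [RHS]exchange_big /=.
rewrite [RHS](reindex_inj (mulIg rot_perm)) /=; apply: eq_bigr => r _.
pose e : grid := [ffun k => (r k == 0)%:R].
rewrite [RHS](reindex_inj (addIr e)) /=; apply: eq_bigr => x _.
congr (\det _); apply/matrixP => k s; rewrite !mxE.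
congr ((l _ == _)%:R); apply/ffunP => u; rewrite !ffunE -addrA; congr (_ + _).
rewrite -natrD; congr (_%:R).
rewrite permM val_rot_perm lift0 lift_max.
have : (k < n)%N by []; case: eqP => [->|rk] /=; first by lia.
have : (r u : nat) <> 0%N by move=> r0; apply: rk; apply/val_inj.
by lia.
Qed.

Lemma sum_det_label l : \sum_x \sum_r \det (label_mx l x r) = 0.
Proof.
have E x : \sum_r \det (label_mx l x r) =
    \sum_r \det (facet_mx l x r ord0) + \sum_r \det (facet_mx l x r ord_max).
  under eq_bigr do rewrite det_label_mx.
  rewrite exchange_big /= (bigD1 ord0) // (bigD1 ord_max) //=; congr (_ + _).
  rewrite -[RHS]addr0; congr (_ + _); apply: big1 => i /andP[i0 im].
  apply: sum_facet_inner.
  move: i0 im; rewrite -!val_eqE /=; have := ltn_ord i; lia.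
under eq_bigr do rewrite E.
by rewrite big_split /= sum_facet_ends addrr_F2.
Qed.

Lemma det_label_full l x r : \det (label_mx l x r) != 0 ->
  forall j : 'I_n.+1, exists i : 'I_n.+1, l (kuhn_vertex x r i) = j.
Proof.
move=> d0 j.
suff /existsP[i /eqP iP] : [exists i : 'I_n.+1, l (kuhn_vertex x r i) == j].
  by exists i.
apply: contraNT d0 => /existsPn jP.
rewrite (expand_det_col _ j) big1 // => i _.
by rewrite mxE (negbTE (jP i)) mul0r.
Qed.

(* One more than the largest index satisfying [P], or 0. *)
Definition top_index (P : pred 'I_n) : 'I_n.+1 := inord (\max_(i | P i) i.+1).

Lemma val_top P : (top_index P : nat) = \max_(i | P i) i.+1.
Proof. by rewrite inordK // ltnS; apply/bigmax_leqP => i _. Qed.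

Lemma ltn_top (P : pred 'I_n) (i : 'I_n) : P i -> (i < top_index P)%N.
Proof.
move=> Pi; rewrite val_top.
exact: (leq_bigmax_cond (F := fun j : 'I_n => j.+1)).
Qed.

Lemma top_eq (P : pred 'I_n) (i : 'I_n) : top_index P = i.+1 :> nat -> P i.
Proof.
rewrite val_top => E.
have [Pj|P0] := pickP P; last first.
  by move: E; rewrite big_pred0.
move=> PPj.
have cP : (0 < #|P|)%N by apply/card_gt0P; exists Pj.
have [j jP jE] := eq_bigmax_cond (fun j : 'I_n => j.+1) cP.
have : j.+1 = i.+1 :> nat by rewrite -jE -E.
by case=> /val_inj <-.
Qed.

(** The threshold is 1 rather than 0 so that a simplex whose base has coordinate 0 in direction [k],
    where its vertices take only the values 0 and 1, misses the label [k.+1]. *)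
Definition ref_label x : 'I_n.+1 := top_index (fun i => 1 < x i)%N.

Definition nonwrap x := [forall k, x k != ord_max].

Lemma val_kuhn_vertex x r j (k : 'I_n) : nonwrap x ->
  (kuhn_vertex x r j k : nat) = (x k + (r k < j))%N.
Proof.
move=> /forallP nw; have xk : (x k : nat) != D.+3 by exact: nw.
have xl := ltn_ord (x k).
by rewrite ffunE /=; case: (r k < j)%N => /=;
  rewrite ?[(1 %% _)%N]modn_small // modn_small //; lia.
Qed.

Lemma incr_perm_id (r : 'S_n) :
  (forall i j : 'I_n, (i < j)%N -> (r i < r j)%N) -> r = 1%g.
Proof.
move=> inc.
have ge (i : 'I_n) : (i <= r i)%N.
  case: i => i; elim: i => [|i IH] hi //=.
  have hi' : (i < n)%N by lia.
  by have := IH hi'; have /= := inc (Ordinal hi') (Ordinal hi) (leqnn _); lia.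
have : \sum_(i : 'I_n) (r i - i)%N = 0%N.
  rewrite sumnB // [X in (_ - X)%N](reindex_inj (@perm_inj _ r)) /=.
  by rewrite subnn.
move/eqP; rewrite sum_nat_eq0 => /forallP E; apply/permP => i; rewrite perm1.
by apply/val_inj; have := E i; have := ge i; rewrite /=; lia.
Qed.

Definition ref_base_point : grid := [ffun=> 1].

Lemma nonwrap_base : nonwrap ref_base_point.
Proof. by apply/forallP => k; rewrite ffunE. Qed.

(** The vertex labelled 0 forces all base coordinates to be at most 1. The vertex labelled [i.+1]
    forces coordinate [i] of the base to be at least 1, and puts [r i] below [r k] for every later
    [k]. *)
Lemma ref_full x r : nonwrap x -> \det (label_mx ref_label x r) != 0 ->
  x = ref_base_point /\ r = 1%g.
Proof.
move=> nw /det_label_full full.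
have atop (i : 'I_n) : exists j : 'I_n.+1,
  (1 < x i + (r i < j))%N /\ forall k : 'I_n, (i < k)%N -> ~~ (1 < x k + (r k < j))%N.
  have [j jE] := full (lift ord0 i); exists j; split.
    have := @top_eq (fun k => 1 < kuhn_vertex x r j k)%N i.
    by rewrite -/(ref_label _) jE val_kuhn_vertex //; apply.
  move=> k ik; apply/negP => H.
  have := @ltn_top (fun k => 1 < kuhn_vertex x r j k)%N k.
  rewrite -/(ref_label _) jE val_kuhn_vertex // lift0 => /(_ H); lia.
have abot (i : 'I_n) : (x i <= 1)%N.
  have [j jE] := full ord0; rewrite leqNgt; apply/negP => H.
  have := @ltn_top (fun k => 1 < kuhn_vertex x r j k)%N i.
  by rewrite -/(ref_label _) jE val_kuhn_vertex // /=; lia.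
have x1 (i : 'I_n) : x i = 1%N :> nat.
  by have [j [+ _]] := atop i; have := abot i; lia.
split; first by apply/ffunP => i; rewrite ffunE; apply/val_inj; rewrite /= x1 modn_small.
apply: incr_perm_id => i j ij; have [k [ki /(_ j ij)]] := atop i.
move: ki; rewrite !x1; lia.
Qed.

Lemma ref_base : label_mx ref_label ref_base_point 1%g = 1%:M.
Proof.
apply/matrixP => i j; rewrite !mxE; congr (_%:R); congr (nat_of_bool (_ == _)).
apply/val_inj; rewrite /= val_top.
under eq_bigl => k do
  rewrite val_kuhn_vertex ?nonwrap_base // ffunE perm1 /= modn_small //.
apply/eqP; rewrite eqn_leq; apply/andP; split.
  by apply/bigmax_leqP => k; lia.
case: i => [[|i] hi] //=.
have hi' : (i < n)%N by lia.
by apply: (leq_bigmax_cond (F := fun j : 'I_n => j.+1) (Ordinal hi') _) => /=; lia.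
Qed.

Definition on_boundary x := [exists k, (x k == ord0) || (x k == ord_max)].

Lemma sperner l : (forall x, on_boundary x -> l x = ref_label x) ->
  exists x r, nonwrap x /\
    forall j : 'I_n.+1, exists i : 'I_n.+1, l (kuhn_vertex x r i) = j.
Proof.
move=> lb.
have agree : \sum_(x | nonwrap x) \sum_r \det (label_mx l x r) =
    \sum_(x | nonwrap x) \sum_r \det (label_mx ref_label x r).
  apply: (addIr (\sum_(x | ~~ nonwrap x) \sum_r \det (label_mx l x r))).
  have -> := esym (bigID nonwrap xpredT (fun x => \sum_r \det (label_mx l x r))).
  rewrite sum_det_label -[LHS](sum_det_label ref_label) (bigID nonwrap) /=.
  (* If the base has a coordinate [ord_max], adding 1 wraps it to 0, so every vertex of the simplex
     is on the boundary, where the two labellings agree. *)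
  congr (_ + _); apply: eq_bigr => x /forallPn[k]; rewrite negbK => /eqP xk.
  apply: eq_bigr => r _; congr (\det _); apply/matrixP => i j; rewrite !mxE lb //.
  apply/existsP; exists k; rewrite ffunE xk.
  case: (r k < i)%N; last by rewrite addr0 eqxx orbT.
  apply/orP; left; apply/eqP/val_inj; rewrite /= [(1 %% _)%N]modn_small //.
  by rewrite addn1 modnn.
have refs : \sum_(x | nonwrap x) \sum_r \det (label_mx ref_label x r) = 1.
  rewrite (bigD1 ref_base_point) ?nonwrap_base //= (bigD1 1%g) //= ref_base det1.
  rewrite big1; last first.
    by move=> r; apply: contraNeq => /(ref_full nonwrap_base) [_ ->].
  rewrite big1 ?addr0 // => x /andP[nw xb]; apply: big1 => r _.
  by apply: contraNeq xb => /(ref_full nw) [->].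
have /existsP[x /andP[nw /existsP[r d0]]] :
    [exists x, nonwrap x && [exists r, \det (label_mx l x r) != 0]].
  apply: contra_eqT refs => /existsPn H; rewrite -agree big1 1?eq_sym ?oner_eq0 //.
  move=> x nw; apply: big1 => r _.
  by have := H x; rewrite nw /= => /existsPn/(_ r); rewrite negbK => /eqP.
by exists x, r; split => //; exact: det_label_full.
Qed.
End Sperner.

(** * Brouwer's fixed point theorem *)

Definition ptcvg (R : realType) (T I : Type) (G : set_system T) (X : T -> I -> R)
  (x : I -> R) := forall i, (fun t => X t i) @ G --> x i.

Section Brouwer.
Variables (R : realType) (m : nat).
Local Notation n := m.+1.

Lemma sperner_approx (F : ('I_n -> R) -> 'I_n -> R) (D : nat) :
  (forall x k, 0 <= F x k <= 1) ->
  exists v : 'I_n.+1 -> 'I_n -> R,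
  [/\ forall j k, 0 <= v j k <= 3,
      forall i j k, `|v i k - v j k| <= D.+1%:R^-1,
      forall k, F (v (lift ord0 k)) k <= v (lift ord0 k) k
    & forall k, v ord0 k <= F (v ord0) k].
Proof.
move=> F01.
(* Index 1 sits at 0 and index [D.+2] at 1. The remaining indices 0, [D.+3] and [D.+4] fall outside
   the unit interval, where the sign of [F x - x] is known. *)
pose pos (k : 'I_D.+1.+4) : R := (k%:R - 1) / D.+1%:R.
have D0 : 0 < D.+1%:R :> R by rewrite ltr0n.
pose rl (x : {ffun 'I_n -> 'I_D.+1.+4}) : 'I_n.+1 :=
  top_index (fun i => F (pos \o x) i < pos (x i)).
pose l x := if on_boundary x then ref_label x else rl x.
have lb x : on_boundary x -> l x = ref_label x by rewrite /l => ->.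
have [x [r [nw full]]] := sperner lb.
have D3 : D.+3%:R = D.+1%:R + 2 :> R by rewrite -natrD addn2.
have pos_le0 (k : 'I_D.+1.+4) : (k <= 1)%N -> pos k <= 0.
  move=> k1; rewrite /pos mulr_le0_ge0 ?invr_ge0 ?ler0n // subr_le0.
  by rewrite (ler_nat R k 1).
have pos_gt1 (k : 'I_D.+1.+4) : (D.+3 <= k)%N -> 1 < pos k.
  move=> k1; rewrite /pos ltr_pdivlMr // mul1r.
  have : (D.+3%:R : R) <= k%:R by rewrite ler_nat.
  by rewrite D3; lra.
have vE (i : 'I_n.+1) k :
    kuhn_vertex x r i k = (x k + (r k < i))%N :> nat.
  exact: val_kuhn_vertex.
(* A fully labelled simplex cannot touch the boundary: with a coordinate [k] equal to 0 it would
   miss the label [k.+1], with one equal to [ord_max] the label 0. So all its labels come from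
   [F]. *)
have inner (j : 'I_n.+1) : ~~ on_boundary (kuhn_vertex x r j).
  apply/negP => /existsP[/= k] /orP[] /eqP jk.
    have xk : x k = 0%N :> nat by have := vE j k; rewrite jk /=; lia.
    have [i iE] := full (lift ord0 k).
    have ik : (kuhn_vertex x r i k <= 1)%N by rewrite vE xk; case: (_ < _)%N.
    have : l (kuhn_vertex x r i) = k.+1 :> nat by rewrite iE lift0.
    rewrite /l; case: ifP => _ /top_eq; first by lia.
    rewrite ltNge => /negP; apply.
    apply: le_trans (pos_le0 _ ik) _.
    by have /andP[] := F01 (pos \o kuhn_vertex x r i) k.
  have xk : (D.+3 <= x k)%N.
    by have := vE j k; rewrite jk /=; case: (_ < _)%N; lia.
  have [i iE] := full ord0.
  have ik : (D.+3 <= kuhn_vertex x r i k)%N by rewrite vE; lia.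
  suff : (k < l (kuhn_vertex x r i))%N by rewrite iE.
  rewrite /l; case: ifP => _; apply: ltn_top; first by lia.
  apply: le_lt_trans (pos_gt1 _ ik).
  by have /andP[] := F01 (pos \o kuhn_vertex x r i) k.
pose idx j := sval (cid (full j)).
have idxP j : rl (kuhn_vertex x r (idx j)) = j.
  rewrite -[RHS](svalP (cid (full j))) -/(idx j) /l.
  by rewrite (negbTE (inner _)).
exists (fun j => pos \o kuhn_vertex x r (idx j)); split.
- move=> j k /=; rewrite /pos.
  have := inner (idx j); rewrite /on_boundary negb_exists => /forallP/(_ k).
  rewrite negb_or -!val_eqE /= => /andP[k0 kD].
  have kl := ltn_ord (kuhn_vertex x r (idx j) k).
  have k1 : 1 <= (kuhn_vertex x r (idx j) k)%:R :> R.
    by rewrite (ler_nat R 1); lia.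
  have k2 : (kuhn_vertex x r (idx j) k)%:R <= D.+3%:R :> R.
    by rewrite ler_nat; lia.
  rewrite divr_ge0 ?subr_ge0 //=.
  rewrite ler_pdivrMr //; move: k2; rewrite D3.
  have : 1 <= D.+1%:R :> R by rewrite (ler_nat R 1).
  lra.
- move=> i j k; rewrite /= /pos -mulrBl normrM normfV [X in _ / X]ger0_norm ?ler0n //.
  rewrite ler_pdivrMr // mulVf ?gt_eqF // opprB addrA subrK.
  rewrite !vE !natrD opprD addrACA subrr add0r.
  by case: (_ < _)%N; case: (_ < _)%N;
    rewrite ?subrr ?subr0 ?sub0r ?normrN ?normr0 ?normr1.
- move=> k; apply/ltW.
  apply: (@top_eq _ (fun i => F (pos \o kuhn_vertex x r (idx (lift ord0 k))) i
    < pos (kuhn_vertex x r (idx (lift ord0 k)) i))).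
  by have := idxP (lift ord0 k); rewrite /rl => ->; rewrite lift0.
- move=> k; rewrite leNgt; apply/negP => /= H.
  have := @ltn_top _ (fun i => F (pos \o kuhn_vertex x r (idx ord0)) i
    < pos (kuhn_vertex x r (idx ord0) i)) k H.
  by rewrite -/(rl _) idxP.
Qed.

Lemma ultra_cvg_bounded (T : Type) (U : set_system T) (X : T -> R) (A B : R) :
  UltraFilter U -> U [set t | A <= X t <= B] ->
  exists x : R, X @ U --> x.
Proof.
move=> UU XB.
have PU : ProperFilter (X @ U) by exact: fmap_proper_filter.
have [|x [_ xU]] := @segment_compact R A B (X @ U).
  suff : U (X @^-1` `[A, B]) by [].
  by apply: filterS XB => t /=; rewrite in_itv.
exists x => W xW; have [//|UW] := in_ultra_setVsetC (X @^-1` W) UU.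
by have [y []] := xU (~` W) W UW xW.
Qed.

Lemma brouwer (F : ('I_n -> R) -> 'I_n -> R) :
  (forall x k, 0 <= F x k <= 1) ->
  (forall (G : set_system ('I_n -> R)) x, ProperFilter G ->
     ptcvg G id x -> ptcvg G F (F x)) ->
  exists x, F x = x.
Proof.
move=> F01 Fc.
pose v D := sval (cid (sperner_approx D F01)).
have vP D := svalP (cid (sperner_approx D F01)).
(* Along an ultrafilter every bounded coordinate converges, which replaces the extraction of
   subsequences. All vertices share one limit because the mesh tends to 0. *)
have [U [UU oU]] := ultraFilterLemma eventually_filter.
have xex k : exists y : R, (fun D => v D ord0 k) @ U --> y.
  apply: (@ultra_cvg_bounded _ _ _ 0 3) => //.
  by apply: nearW => D; have [+ _ _ _] := vP D; exact.
pose x k := sval (cid (xex k)).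
have x0 k : (fun D => v D ord0 k) @ U --> x k by exact: svalP (cid (xex k)).
have vx j : ptcvg U (fun D => v D j) x.
  move=> k.
  have d0 : (fun D => v D j k - v D ord0 k) @ U --> (0 : R).
    apply: cvg_trans (_ : (fun D => v D j k - v D ord0 k) @ \oo --> 0).
      exact: cvg_app.
    apply: norm_cvg0; apply: (@squeeze_cvgr _ _ _ _ (fun=> 0) (@harmonic R)).
    - by near=> D; rewrite normr_ge0 /=; have [_ + _ _] := vP D; exact.
    - exact: cvg_cst.
    - exact: cvg_harmonic.
  rewrite -[x k]add0r.
  have -> : (fun D => v D j k) = (fun D => v D j k - v D ord0 k + v D ord0 k).
    by apply/funext => D; rewrite subrK.
  exact: cvgD.
have Fv j k : (fun D => F (v D j) k) @ U --> F x k.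
  exact: (Fc ((fun D => v D j) @ U) x (fmap_proper_filter _ _) (vx j)).
exists x; apply/funext => k; apply/eqP; rewrite eq_le; apply/andP; split.
  apply: ler_cvg_to (Fv (lift ord0 k) k) (vx (lift ord0 k) k) _.
  by apply: nearW => D; have [_ _ + _] := vP D; exact.
apply: ler_cvg_to (vx ord0 k) (Fv ord0 k) _.
by apply: nearW => D; have [_ _ _ +] := vP D; exact.
Unshelve. all: by end_near. Qed.
End Brouwer.

(** * Tychonoff's fixed point theorem in a power of the real line *)

Lemma cvg_maxr (R : realType) (T : Type) (G : set_system T) (X Y : T -> R)
  (x y : R) : Filter G -> X @ G --> x -> Y @ G --> y ->
  (fun t => Num.max (X t) (Y t)) @ G --> Num.max x y.
Proof.
move=> FG Xx Yy; rewrite maxr_absE; under eq_fun do rewrite maxr_absE.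
apply: cvgM; last exact: cvg_cst.
by apply: cvgD; [exact: cvgD | apply: cvg_norm; exact: cvgB].
Qed.

Lemma cvg_sumr (R : realType) (T I : Type) (G : set_system T) (r : seq I)
  (X : T -> I -> R) (x : I -> R) : Filter G -> ptcvg G X x ->
  (fun t => \sum_(i <- r) X t i) @ G --> \sum_(i <- r) x i.
Proof.
move=> FG Xx; elim: r => [|i r IH].
  rewrite big_nil; under eq_fun do rewrite big_nil; exact: cvg_cst.
rewrite big_cons; under eq_fun do rewrite big_cons; exact: cvgD.
Qed.

(* Unlike [ler_cvg_to], the filter lives on an arbitrary type. *)
Lemma ler_cvg (R : realType) (T : Type) (G : set_system T) (X Y : T -> R)
  (x y : R) : ProperFilter G -> X @ G --> x -> Y @ G --> y ->
  (\forall t \near G, X t <= Y t) -> x <= y.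
Proof.
move=> PG Xx Yy XY; rewrite -subr_ge0.
have XYd : (Y - X) @ G --> y - x by exact: cvgB.
rewrite -(cvg_lim _ XYd) //; apply: limr_ge; first by apply/cvg_ex; exists (y - x).
by apply: filterS XY => t; rewrite /= subr_ge0.
Qed.

(** * A continuous retraction onto the standard simplex *)

Section Retraction.
Variables (R : realType) (m : nat).
Local Notation n := m.+1.
Implicit Types x : 'I_n -> R.

(** The second summand vanishes on the simplex and keeps the total at least 1, so that normalising
    is continuous everywhere. *)
Definition pos_coord x k : R :=
  Num.max 0 (x k) + Num.max 0 (1 - \sum_j Num.max 0 (x j)).

Definition simplex_retr x k : R := pos_coord x k / \sum_j pos_coord x j.

Lemma pos_coord_ge0 x k : 0 <= pos_coord x k.
Proof. by rewrite addr_ge0 // le_max lexx. Qed.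

Lemma sum_pos_coord x : 1 <= \sum_j pos_coord x j.
Proof.
pose s := \sum_j Num.max 0 (x j).
have : s + Num.max 0 (1 - s) <= \sum_j pos_coord x j.
  rewrite big_split /= lerD2l sumr_const card_ord mulrS lerDl.
  by rewrite mulrn_wge0 // le_max lexx.
have : 1 - s <= Num.max 0 (1 - s) by rewrite le_max lexx orbT.
lra.
Qed.

Lemma simplex_retr_ge0 x k : 0 <= simplex_retr x k.
Proof.
by rewrite divr_ge0 ?pos_coord_ge0 // (le_trans _ (sum_pos_coord x)).
Qed.

Lemma sum_simplex_retr x : \sum_k simplex_retr x k = 1.
Proof.
rewrite -mulr_suml divff // gt_eqF // (lt_le_trans _ (sum_pos_coord x)) //.
Qed.

Lemma simplex_retr_id x : (forall k, 0 <= x k) -> \sum_k x k = 1 ->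
  simplex_retr x = x.
Proof.
move=> x0 x1; apply/funext => k.
have xE j : Num.max 0 (x j) = x j by apply/max_idPr.
have pE j : pos_coord x j = x j.
  rewrite /pos_coord; under eq_bigr do rewrite xE.
  by rewrite x1 subrr maxxx addr0.
by rewrite /simplex_retr pE; under eq_bigr do rewrite pE; rewrite x1 divr1.
Qed.

Lemma simplex_retr_cvg (G : set_system ('I_n -> R)) x : Filter G ->
  ptcvg G id x -> ptcvg G simplex_retr (simplex_retr x).
Proof.
move=> FG Gx.
have pG : ptcvg G pos_coord (pos_coord x).
  have mG : ptcvg G (fun y j => Num.max 0 (y j)) (fun j => Num.max 0 (x j)).
    by move=> j; apply: cvg_maxr; [exact: cvg_cst | exact: Gx].
  move=> k; apply: cvgD; first exact: mG.
  apply: cvg_maxr; first exact: cvg_cst.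
  apply: cvgB; first exact: cvg_cst.
  exact: (@cvg_sumr R _ _ G _ (fun y j => Num.max 0 (y j)) (fun j => Num.max 0 (x j))).
move=> k; apply: cvgM; first exact: pG.
apply: cvgV; last exact: cvg_sumr.
by rewrite gt_eqF // (lt_le_trans _ (sum_pos_coord x)).
Qed.
End Retraction.

Section Tychonoff.
Variables (R : realType) (I : Type) (C : set (I -> R)).
Variable Psi : (I -> R) -> I -> R.
Hypothesis convC : forall x y t, C x -> C y -> 0 <= t <= 1 ->
  C (fun i => t * x i + (1 - t) * y i).
Hypothesis C0 : C !=set0.
Hypothesis bndC : forall i, exists A B, forall x, C x -> A <= x i <= B.
Hypothesis clC : forall (G : set_system (I -> R)) x,
  ProperFilter G -> G C -> ptcvg G id x -> C x.
Hypothesis mapC : forall x, C x -> C (Psi x).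
Hypothesis contPsi : forall (G : set_system (I -> R)) x,
  ProperFilter G -> G C -> C x -> ptcvg G id x -> ptcvg G Psi (Psi x).

Lemma conv_sum m (y : 'I_m.+1 -> I -> R) (lam : 'I_m.+1 -> R) :
  (forall k, C (y k)) -> (forall k, 0 <= lam k) -> \sum_k lam k = 1 ->
  C (fun i => \sum_k lam k * y k i).
Proof.
elim: m y lam => [|m IH] y lam Cy lam0 lam1.
  move: lam1; rewrite big_ord1 => l1.
  rewrite (_ : (fun i => _) = y ord0) //.
  by apply/funext => i; rewrite big_ord1 l1 mul1r.
pose s := \sum_(k < m.+1) lam (widen_ord (leqnSn m.+1) k).
have sE : s + lam ord_max = 1 by rewrite -lam1 big_ord_recr.
have s0 : 0 <= s by apply: sumr_ge0.
have := lam0 ord_max => l0.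
have [s00|sn0] := eqVneq s 0.
  rewrite (_ : (fun i => _) = y ord_max) //; apply/funext => i.
  have lmax : lam ord_max = 1 by rewrite -sE s00 add0r.
  rewrite big_ord_recr /= lmax mul1r big1 ?add0r // => k _.
  by rewrite (psumr_eq0P _ s00) ?mul0r.
have -> : (fun i => \sum_k lam k * y k i) =
    (fun i => s * (\sum_(k < m.+1) (lam (widen_ord (leqnSn m.+1) k) / s)
        * y (widen_ord (leqnSn m.+1) k) i) + (1 - s) * y ord_max i).
  apply/funext => i; rewrite big_ord_recr /= mulr_sumr -sE addrAC subrr add0r.
  by congr (_ + _); apply: eq_bigr => k _; rewrite mulrA mulrCA divff ?mulr1.
apply: convC => //; last by rewrite s0 -sE lerDl.
apply: IH => // [k|]; first by rewrite divr_ge0.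
by rewrite -mulr_suml divff.
Qed.

(* A fixed point of the Brouwer map built from the positive parts [al] of
   [p (x - Psi x) - p (y k - Psi x)] makes all of them vanish, since
   [p (x - Psi x)] is at most the barycentric mean of the [p (y k - Psi x)]. *)
Lemma ky_fan m (y : 'I_m.+1 -> I -> R) (r : seq I) : (forall k, C (y k)) ->
  exists2 x, C x & forall k,
    \sum_(i <- r) `|x i - Psi x i| <= \sum_(i <- r) `|y k i - Psi x i|.
Proof.
move=> Cy.
pose comb (lam : 'I_m.+1 -> R) i := \sum_k simplex_retr lam k * y k i.
have Ccomb lam : C (comb lam).
  by apply: conv_sum => //; [exact: simplex_retr_ge0|exact: sum_simplex_retr].
pose p (w z : I -> R) := \sum_(i <- r) `|w i - z i|.
pose al lam k := Num.max 0 (p (comb lam) (Psi (comb lam)) - p (y k) (Psi (comb lam))).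
have al0 lam k : 0 <= al lam k by rewrite le_max lexx.
have sal0 lam : 0 <= \sum_k al lam k by apply: sumr_ge0.
pose F lam k := (simplex_retr lam k + al lam k) / (1 + \sum_j al lam j).
have F0 lam k : 0 <= F lam k.
  by rewrite divr_ge0 ?addr_ge0 ?simplex_retr_ge0.
have F1 lam : \sum_k F lam k = 1.
  rewrite -mulr_suml big_split /= sum_simplex_retr divff // gt_eqF //.
  by rewrite ltr_wpDr.
have F01 lam k : 0 <= F lam k <= 1.
  rewrite F0 /= -(F1 lam) (bigD1 k) //= lerDl sumr_ge0 // => j _.
have [G lam PG Gl|lam lamE] := brouwer F01.
  have combG : ptcvg G comb (comb lam).
    move=> i; apply: (@cvg_sumr R _ _ G _ (fun l k => simplex_retr l k * y k i)
      (fun k => simplex_retr lam k * y k i)) => k.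
    by apply: cvgM; [exact: simplex_retr_cvg|exact: cvg_cst].
  have PsiG : ptcvg G (Psi \o comb) (Psi (comb lam)).
    apply: (@contPsi (comb @ G) (comb lam) (fmap_proper_filter comb PG)) => //.
    by apply: nearW => l; exact: Ccomb.
  have alG : ptcvg G al (al lam).
    move=> k; apply: cvg_maxr; first exact: cvg_cst.
    apply: cvgB.
      apply: (@cvg_sumr R _ _ G _ (fun l i => `|comb l i - Psi (comb l) i|)
        (fun i => `|comb lam i - Psi (comb lam) i|)) => i.
      by apply: cvg_norm; apply: cvgB; [exact: combG|exact: PsiG].
    apply: (@cvg_sumr R _ _ G _ (fun l i => `|y k i - Psi (comb l) i|)
      (fun i => `|y k i - Psi (comb lam) i|)) => i.
    by apply: cvg_norm; apply: cvgB; [exact: cvg_cst|exact: PsiG].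
  move=> k; apply: cvgM.
    by apply: cvgD; [exact: simplex_retr_cvg|exact: alG].
  apply: cvgV; first by rewrite gt_eqF // ltr_wpDr.
  by apply: cvgD; [exact: cvg_cst|exact: cvg_sumr].
have lam0 k : 0 <= lam k by rewrite -lamE.
have lam1 : \sum_k lam k = 1 by rewrite -lamE.
have rE := simplex_retr_id lam0 lam1.
exists (comb lam) => // k.
pose x := comb lam; pose A := \sum_j al lam j.
have lamA j : lam j * A = al lam j.
  have : F lam j = lam j by rewrite lamE.
  rewrite /F rE => /(congr1 (fun u => u * (1 + A))).
  rewrite divfK ?gt_eqF ?ltr_wpDr // mulrDr mulr1 => /addrI -> //.
suff A0 : A = 0.
  have : p x (Psi x) - p (y k) (Psi x) <= al lam k by rewrite le_max lexx orbT.
  by rewrite -lamA A0 mulr0 subr_le0.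
have px : p x (Psi x) <= \sum_j lam j * p (y j) (Psi x).
  under [leRHS]eq_bigr do rewrite mulr_sumr.
  rewrite exchange_big /=; apply: ler_sum => i _.
  have -> : x i - Psi x i = \sum_j lam j * (y j i - Psi x i).
    under eq_bigr do rewrite mulrBr.
    by rewrite sumrB -mulr_suml lam1 mul1r /x /comb rE.
  apply: le_trans (ler_norm_sum _ _ _) _; apply: ler_sum => j _.
  by rewrite normrM ger0_norm.
apply/eqP/negP => /negP A0.
have E j : lam j * al lam j = lam j * (p x (Psi x) - p (y j) (Psi x)).
  have [->|l0] := eqVneq (lam j) 0; first by rewrite !mul0r.
  have : al lam j != 0 by rewrite -lamA mulf_neq0.
  rewrite /al -/x; case: (leP 0 (p x (Psi x) - _)) => // _.
  by rewrite eqxx.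
have : \sum_j lam j * al lam j <= 0.
  under eq_bigr do rewrite E mulrBr.
  by rewrite sumrB -mulr_suml lam1 mul1r subr_le0.
rewrite le_eqVlt ltNge sumr_ge0 ?orbF => [|j _]; last by rewrite mulr_ge0.
rewrite psumr_eq0 => [/allP lal|j _]; last by rewrite mulr_ge0.
have : \sum_k lam k = 0.
  apply: big1 => j _; apply/eqP; have := lal j (mem_index_enum _).
  by rewrite /= -lamA !mulf_eq0 (negbTE A0) orbF orbb.
by rewrite lam1 => /eqP; rewrite oner_eq0.
Qed.

(** The finite intersection property of [C]: solutions for finite lists of conditions converge along
    an ultrafilter containing, for each list, the set of all lists that extend it. *)
Lemma compact_choice (A : Type) (P : A -> (I -> R) -> Prop) :
  (forall a (G : set_system (I -> R)) x, ProperFilter G -> G C -> G (P a) ->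
     C x -> ptcvg G id x -> P a x) ->
  (forall s : seq A, exists2 x, C x & forall a, List.In a s -> P a x) ->
  exists2 x, C x & forall a, P a x.
Proof.
move=> clP fin.
pose X s := s2val (cid2 (fin s)).
have CX s : C (X s) by rewrite /X; case: (cid2 (fin s)).
have PX s a : List.In a s -> P a (X s).
  by rewrite /X; case: (cid2 (fin s)) => ? ? /=; exact.
pose G : set_system (seq A) :=
  [set S | exists s0, forall s, (forall a, List.In a s0 -> List.In a s) -> S s].
have PG : ProperFilter G.
  apply: Build_ProperFilter_ex => [S [s0 s0S]|]; first by exists s0; exact: s0S.
  split.
  - by exists [::].
  - move=> S T [s sS] [t tT]; exists (s ++ t) => u stu; split.
      by apply: sS => a sa; apply: stu; apply: List.in_or_app; left.
    by apply: tT => a sa; apply: stu; apply: List.in_or_app; right.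
  - by move=> S T ST [s sS]; exists s => t st; exact/ST/sS.
have [U [UU GU]] := ultraFilterLemma PG.
have xex i : exists x : R, (fun s => X s i) @ U --> x.
  have [B1 [B2 B12]] := bndC i.
  apply: (@ultra_cvg_bounded _ _ _ _ B1 B2) => //.
  by apply: nearW => s; exact: B12.
pose x i := sval (cid (xex i)).
have xU : ptcvg (X @ U) id x by move=> i; exact: (svalP (cid (xex i))).
have PU : ProperFilter (X @ U) by exact: fmap_proper_filter.
have CU : (X @ U) C by apply: nearW => s; exact: CX.
have Cx : C x by exact: clC xU.
exists x => // a; apply: clP (xU) => //.
by apply: GU; exists [:: a] => s /(_ a) sa; apply: PX; apply: sa; left.
Qed.

Lemma tychonoff_fixpoint : exists2 x, C x & Psi x = x.
Proof.
suff [x Cx Px] : exists2 x, C x & forall i, Psi x i = x i.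
  by exists x => //; exact/funext.
(* By compactness it is enough to solve finitely many coordinate equations at a time. *)
apply: compact_choice => [i G x PG GC GP Cx Gx|r].
  have PG' := (contPsi PG GC Cx Gx : ptcvg _ _ _) i.
  apply: (cvg_unique _ PG') => //.
  apply: cvg_trans (Gx i); apply: near_eq_cvg.
  by apply: filterS GP.
(* The choice [y = Psi x] makes the right-hand side 0. A second use of compactness, now over the
   test points [y], reduces this to the finite families of [ky_fan]. *)
suff [x Cx Px] : exists2 x, C x & forall y, C y ->
    \sum_(i <- r) `|x i - Psi x i| <= \sum_(i <- r) `|y i - Psi x i|.
  exists x => // i ir; have := Px _ (mapC Cx).
  rewrite [leRHS]big1 => [H|j _]; last by rewrite subrr normr0.
  apply/esym/eqP; rewrite -subr_eq0 -normr_le0.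
  elim: r ir H {Px} => //= j r IH [->|ir]; rewrite big_cons => H.
    by apply: le_trans H; rewrite lerDl sumr_ge0.
  by apply: IH => //; apply: le_trans H; rewrite lerDr.
pose P (y : {y : I -> R | C y}) (x : I -> R) :=
    \sum_(i <- r) `|x i - Psi x i| <= \sum_(i <- r) `|sval y i - Psi x i|.
suff [x Cx Px] : exists2 x, C x & forall y, P y x.
  by exists x => // y Cy; exact: (Px (exist _ y Cy)).
apply: compact_choice => [y G x PG GC GP Cx Gx|s].
  have PG' := contPsi PG GC Cx Gx.
  have lcvg : (fun x => \sum_(i <- r) `|x i - Psi x i|) @ G -->
      \sum_(i <- r) `|x i - Psi x i|.
    apply: (@cvg_sumr R _ _ G _ (fun x i => `|x i - Psi x i|)
        (fun i => `|x i - Psi x i|)) => i.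
    by apply: cvg_norm; apply: cvgB; [exact: Gx|exact: PG'].
  have rcvg : (fun x => \sum_(i <- r) `|sval y i - Psi x i|) @ G -->
      \sum_(i <- r) `|sval y i - Psi x i|.
    apply: (@cvg_sumr R _ _ G _ (fun x i => `|sval y i - Psi x i|)
        (fun i => `|sval y i - Psi x i|)) => i.
    by apply: cvg_norm; apply: cvgB; [exact: cvg_cst|exact: PG'].
  exact: (ler_cvg PG lcvg rcvg GP).
case: s => [|y0 s]; first by have [x Cx] := C0; exists x.
have [x Cx xP] := @ky_fan (size s) _ r (fun k => svalP (nth y0 (y0 :: s) k)).
exists x => // y ys.
suff [k ks ->] : exists2 k, (k < (size s).+1)%N & y = nth y0 (y0 :: s) k.
  exact: (xP (Ordinal ks)).
case: ys => [<-|]; first by exists 0%N.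
elim: s {xP} => //= z s IH [<-|/IH [[|k] ks ->]]; first by exists 1%N.
  by exists 0%N.
by exists k.+2.
Qed.
End Tychonoff.

(** * Equicontinuous functions on the unit interval *)

Section Extrema.
Variable R : realType.
Implicit Types (A : set R) (w : R -> R).

Lemma max_on_ge A w B t : (forall s, A s -> w s <= B) -> A t -> w t <= max_on A w.
Proof.
move=> wB At; apply: ub_le_sup; last by exists t.
by exists B => _ [s As <-]; exact: wB.
Qed.

Lemma max_on_le A w B : A !=set0 -> (forall s, A s -> w s <= B) -> max_on A w <= B.
Proof.
move=> [t At] wB; apply: ge_sup; first by exists (w t); exists t.
by move=> _ [s As <-]; exact: wB.
Qed.

Lemma min_on_le A w B t : (forall s, A s -> B <= w s) -> A t -> min_on A w <= w t.
Proof.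
move=> wB At; apply: ge_inf; last by exists t.
by exists B => _ [s As <-]; exact: wB.
Qed.

Lemma min_on_ge A w B : A !=set0 -> (forall s, A s -> B <= w s) -> B <= min_on A w.
Proof.
move=> [t At] wB; apply: lb_le_inf; first by exists (w t); exists t.
by move=> _ [s As <-]; exact: wB.
Qed.

Definition ucvg (T : Type) (G : set_system T) (U : T -> R -> R) (u : R -> R) :=
  forall e, 0 < e -> \forall z \near G, forall t, `|U z t - u t| <= e.

Lemma ucvg_ptcvg (T : Type) (G : set_system T) U u : Filter G ->
  ucvg G U u -> ptcvg G U u.
Proof.
move=> FG Uu t; apply/cvgrPdist_le => e e0.
by apply: filterS (Uu e e0) => z /(_ t); rewrite distrC.
Qed.

Lemma max_on_cvg (T : Type) (G : set_system T) (U : T -> R -> R) u A B :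
  Filter G -> A !=set0 -> (forall t, u t <= B) ->
  ucvg G U u -> (fun z => max_on A (U z)) @ G --> max_on A u.
Proof.
move=> FG A0 uB Uu; apply/cvgrPdist_le => e e0.
apply: filterS (Uu e e0) => z Uz.
have UB t : U z t <= B + e by have := Uz t; have := uB t; rewrite ler_norml; lra.
have h1 : max_on A u <= max_on A (U z) + e.
  apply: max_on_le => // t At; have := Uz t; rewrite ler_norml.
  have := @max_on_ge A (U z) _ t (fun s _ => UB s) At; lra.
have h2 : max_on A (U z) <= max_on A u + e.
  apply: max_on_le => // t At; have := Uz t; rewrite ler_norml.
  have := @max_on_ge A u _ t (fun s _ => uB s) At; lra.
rewrite ler_norml; lra.
Qed.

Lemma min_on_cvg (T : Type) (G : set_system T) (U : T -> R -> R) u A B :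
  Filter G -> A !=set0 -> (forall t, B <= u t) ->
  ucvg G U u -> (fun z => min_on A (U z)) @ G --> min_on A u.
Proof.
move=> FG A0 uB Uu; apply/cvgrPdist_le => e e0.
apply: filterS (Uu e e0) => z Uz.
have UB t : B - e <= U z t by have := Uz t; have := uB t; rewrite ler_norml; lra.
have h1 : min_on A (U z) - e <= min_on A u.
  apply: min_on_ge => // t At; have := Uz t; rewrite ler_norml.
  have := @min_on_le A (U z) _ t (fun s _ => UB s) At; lra.
have h2 : min_on A u - e <= min_on A (U z).
  apply: min_on_ge => // t At; have := Uz t; rewrite ler_norml.
  have := @min_on_le A u _ t (fun s _ => uB s) At; lra.
rewrite ler_norml; lra.
Qed.

Lemma ucvgZ (T : Type) (G : set_system T) (S : T -> R)
    (W : T -> R -> R) (s : R) w (B : R) :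
  Filter G -> (forall t, `|w t| <= B) -> S @ G --> s -> ucvg G W w ->
  ucvg G (fun z t => S z * W z t) (fun t => s * w t).
Proof.
move=> FG wB Ss Ww e e0.
have B0 : 0 <= B by apply: le_trans (wB 0).
have d0 : 0 < e / (2 * (B + 1)) by rewrite divr_gt0 ?mulr_gt0 //; lra.
have d1 : 0 < e / (2 * (`|s| + e / (2 * (B + 1)))).
  by rewrite divr_gt0 ?mulr_gt0 // ltr_wpDl.
near=> z.
have hS : `|S z - s| <= e / (2 * (B + 1)).
  by rewrite distrC; near: z; move/cvgrPdist_le : Ss; exact.
have hWz : forall t, `|W z t - w t| <= e / (2 * (`|s| + e / (2 * (B + 1)))).
  by near: z; exact: Ww.
move=> t; have hW := hWz t.
have -> : S z * W z t - s * w t = S z * (W z t - w t) + (S z - s) * w t by ring.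
apply: le_trans (ler_normD _ _) _; rewrite !normrM.
rewrite [leRHS](splitr e); apply: lerD.
  have Sz : `|S z| <= `|s| + e / (2 * (B + 1)).
    have := ler_normD (S z - s) s; rewrite subrK; lra.
  apply: le_trans (ler_pM _ _ Sz hW) _ => //.
  set D := `|s| + _; have D0 : D != 0 by rewrite gt_eqF // ltr_wpDl.
  by rewrite le_eqVlt; apply/orP; left; apply/eqP; field.
apply: le_trans (ler_pM _ _ hS (wB t)) _ => //.
have B1 : B + 1 != 0 by rewrite gt_eqF //; lra.
have -> : e / (2 * (B + 1)) * B = e / 2 * (B / (B + 1)) by field.
rewrite ler_piMr //; first by rewrite divr_ge0 // ltW.
by rewrite ler_pdivrMr ?mul1r; lra.
Unshelve. all: by end_near. Qed.

Definition clamp (lo hi t : R) := Num.max lo (Num.min hi t).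

Lemma clamp_itv lo hi t : lo <= hi -> lo <= clamp lo hi t <= hi.
Proof. by move=> lh; rewrite /clamp le_max lexx /= ge_max lh ge_min lexx. Qed.

Lemma clamp_id lo hi t : lo <= t <= hi -> clamp lo hi t = t.
Proof.
by move=> /andP[lt th]; rewrite /clamp (min_idPr th) (max_idPr lt).
Qed.

Lemma clamp_lip lo hi t t' : `|clamp lo hi t - clamp lo hi t'| <= `|t - t'|.
Proof.
have maxl (c x y : R) : `|Num.max c x - Num.max c y| <= `|x - y|.
  by case: (leP c x) => ?; case: (leP c y) => ?; rewrite ler_norml;
    case: (ler0P (x - y)) => ?; lra.
apply: le_trans (maxl _ _ _) _.
by case: (leP hi t) => ?; case: (leP hi t') => ?; rewrite ler_norml;
  case: (ler0P (t - t')) => ?; lra.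
Qed.

(* Functions with modulus of continuity [d] on the unit interval, extended to
   the line by constants. *)
Definition equi (d : R -> R) (w : R -> R) := forall e t t', 0 < e ->
  `|clamp 0 1 t - clamp 0 1 t'| <= d e -> `|w t - w t'| <= e.

Lemma equi_continuous d w : (forall e, 0 < e -> 0 < d e) -> equi d w -> continuous w.
Proof.
move=> d0 dw t; apply/cvgrPdist_le => e e0; near=> t'.
apply: dw => //; apply: le_trans (clamp_lip _ _ _ _) _; near: t'.
by apply: (@cvgr_dist_le _ _ _ (nbhs t) _ id) => //; exact: d0.
Unshelve. all: by end_near. Qed.

Lemma equi_clamp d w t : (forall e, 0 < e -> 0 < d e) -> equi d w ->
  w (clamp 0 1 t) = w t.
Proof.
move=> d0 dw; apply/eqP; rewrite -subr_eq0 -normr_le0; apply/ler_addgt0Pr => e e0.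
rewrite add0r; apply: dw => //.
by rewrite (@clamp_id _ _ (clamp _ _ _)) ?clamp_itv // subrr normr0 ltW // d0.
Qed.

Lemma equi_ucvg (T : Type) (G : set_system T) (d : R -> R) (U : T -> R -> R) u :
  Filter G -> (forall e, 0 < e -> 0 < d e) ->
  (\forall z \near G, equi d (U z)) -> equi d u -> ptcvg G U u -> ucvg G U u.
Proof.
move=> FG d0 dU du Uu e e0.
have e3 : 0 < e / 3 by rewrite divr_gt0.
have [N N0 Nd] : exists2 N : nat, (0 < N)%N & N%:R^-1 <= d (e / 3).
  have dp := d0 _ e3.
  exists (Num.truncn (d (e / 3))^-1).+1 => //.
  rewrite invf_ple ?posrE ?ltr0n // ltW //.
  by rewrite truncnS_gt.
have fin : \forall z \near G, forall j : 'I_N.+1,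
    `|U z (j%:R / N%:R) - u (j%:R / N%:R)| <= e / 3.
  apply: filter_forall => j; have /cvgrPdist_le/(_ _ e3) := Uu (j%:R / N%:R).
  by apply: filterS => z; rewrite distrC.
near=> z.
have dz : equi d (U z) by near: z.
have zj : forall j : 'I_N.+1, `|U z (j%:R / N%:R) - u (j%:R / N%:R)| <= e / 3.
  by near: z.
move=> t; have [j jt] : exists j : 'I_N.+1,
    `|clamp 0 1 t - clamp 0 1 (j%:R / N%:R)| <= N%:R^-1.
  have /andP[c0 c1] := @clamp_itv 0 1 t ler01.
  have N0' : 0 < N%:R :> R by rewrite ltr0n.
  have /andP[t1 t2] : (Num.truncn (clamp 0 1 t * N%:R))%:R <= clamp 0 1 t * N%:R <
      (Num.truncn (clamp 0 1 t * N%:R)).+1%:R.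
    by apply: truncn_itv; rewrite mulr_ge0 // ltW.
  have jN : (Num.truncn (clamp 0 1 t * N%:R) < N.+1)%N.
    rewrite ltnS -(ler_nat R); apply: le_trans t1 _.
    by rewrite ler_piMl // ltW.
  exists (Ordinal jN); rewrite (@clamp_id _ _ (_ / _)) /=; last first.
    rewrite divr_ge0 ?ler0n //= ler_pdivrMr // mul1r.
    by apply: le_trans t1 _; rewrite ler_piMl // ltW.
  set c := clamp 0 1 t in c0 c1 t1 t2 *; set q := (Num.truncn _)%:R in t1 *.
  have -> : c - q / N%:R = (c * N%:R - q) / N%:R by field; rewrite gt_eqF.
  rewrite normrM normfV (ger0_norm (ltW N0')) ler_piMl ?invr_ge0 ?(ltW N0') //.
  by rewrite ler_norml; move: t2; rewrite -addn1 natrD -/q; lra.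
have h1 := dz (e / 3) t (j%:R / N%:R) e3 (le_trans jt Nd).
have h2 := du (e / 3) t (j%:R / N%:R) e3 (le_trans jt Nd).
have h3 := zj j.
move: h1 h2 h3; rewrite !ler_norml; lra.
Unshelve. all: by end_near. Qed.

End Extrema.

(** * Fixed points of pairs of functions *)

Section PairFixpoint.
Variable R : realType.
Local Notation func := (R -> R).

Definition convex_set (P : set func) := forall x y t, P x -> P y -> 0 <= t <= 1 ->
  P (fun i => t * x i + (1 - t) * y i).

Definition ptclosed (P : set func) := forall (G : set_system func) u,
  ProperFilter G -> G P -> ptcvg G id u -> P u.

(** A pair of functions is one point of the power of the line indexed by [bool * R]. As [P] and [Q]
    share the modulus [d], continuity has to be tested along uniformly convergent families only. *)
Lemma pair_fixpoint (d : R -> R) (B : R) (P Q : set func)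
    (Psi1 Psi2 : func -> func -> func) :
  (forall e, 0 < e -> 0 < d e) ->
  P !=set0 -> Q !=set0 -> convex_set P -> convex_set Q ->
  ptclosed P -> ptclosed Q ->
  (forall w, P w \/ Q w -> equi d w /\ forall t, `|w t| <= B) ->
  (forall u v, P u -> Q v -> P (Psi1 u v) /\ Q (Psi2 u v)) ->
  (forall (G : set_system (func * func)) u v, ProperFilter G ->
    (\forall z \near G, P z.1 /\ Q z.2) -> P u -> Q v ->
    ucvg G fst u -> ucvg G snd v ->
    ptcvg G (fun z => Psi1 z.1 z.2) (Psi1 u v) /\
    ptcvg G (fun z => Psi2 z.1 z.2) (Psi2 u v)) ->
  exists u v, [/\ P u, Q v, Psi1 u v = u & Psi2 u v = v].
Proof.
move=> d0 [u0 Pu0] [v0 Qv0] cP cQ clP clQ PQ maps cont.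
pose dec (z : bool * R -> R) : func * func :=
  ((fun t => z (true, t)), (fun t => z (false, t))).
pose enc (p : func * func) (i : bool * R) := if i.1 then p.1 i.2 else p.2 i.2.
pose C : set (bool * R -> R) := [set z | P (dec z).1 /\ Q (dec z).2].
pose Psi z := enc (Psi1 (dec z).1 (dec z).2, Psi2 (dec z).1 (dec z).2).
have [||||||z [Pz Qz] zE] := @tychonoff_fixpoint R (bool * R)%type C Psi.
- by move=> x y t [Px Qx] [Py Qy] t01; split; [exact: cP|exact: cQ].
- by exists (enc (u0, v0)).
- move=> [b t]; exists (- B), B => z [Pz Qz]; rewrite -ler_norml.
  by case: b; [have [_] := PQ _ (or_introl Pz)|have [_] := PQ _ (or_intror Qz)]; exact.
- move=> G x PG GC Gx; split.
    apply: (clP _ _ (fmap_proper_filter (fst \o dec) PG)).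
      by apply: (@filterS _ G _ C) GC => z [].
    by move=> t; exact: Gx.
  apply: (clQ _ _ (fmap_proper_filter (snd \o dec) PG)).
    by apply: (@filterS _ G _ C) GC => z [].
  by move=> t; exact: Gx.
- by move=> z [Pz Qz]; split; have [] := maps _ _ Pz Qz.
- move=> G z PG GC [Pz Qz] Gz.
  have [|||c1 c2] := cont (dec @ G) _ _ (fmap_proper_filter dec PG) _ Pz Qz.
  + exact: (@filterS _ G _ C) GC.
  + apply: (@equi_ucvg _ _ _ d) => //.
    * by apply: (@filterS _ G _ C) GC => z' [/= Pz' _]; have [] := PQ _ (or_introl Pz').
    * by have [] := PQ _ (or_introl Pz).
    * by move=> t; exact: Gz.
  + apply: (@equi_ucvg _ _ _ d) => //.
    * by apply: (@filterS _ G _ C) GC => z' [/= _ Qz']; have [] := PQ _ (or_intror Qz').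
    * by have [] := PQ _ (or_intror Qz).
    * by move=> t; exact: Gz.
  + by move=> [[] t]; [exact: c1|exact: c2].
exists (dec z).1, (dec z).2; split => //; apply/funext => t.
  by rewrite -[RHS](congr1 (@^~ (true, t)) zE).
by rewrite -[RHS](congr1 (@^~ (false, t)) zE).
Qed.
End PairFixpoint.

(** * Convex, pointwise closed sets of functions *)

Section Closedness.
Variable R : realType.
Local Notation func := (R -> R).

Lemma convex_setI (P Q : set func) : convex_set P -> convex_set Q -> convex_set (P `&` Q).
Proof. by move=> cP cQ x y t [? ?] [? ?] t01; split; [exact: cP|exact: cQ]. Qed.

Lemma ptclosedI (P Q : set func) : ptclosed P -> ptclosed Q -> ptclosed (P `&` Q).
Proof.
move=> cP cQ G u PG GPQ Gu; split; [apply: cP Gu|apply: cQ Gu] => //;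
by apply: filterS GPQ => w [].
Qed.

Lemma convex_equi (d : R -> R) : convex_set (equi d).
Proof.
move=> x y s dx dy /andP[s0 s1] e t t' e0 tt'.
have := dx e t t' e0 tt'; have := dy e t t' e0 tt'.
set X := x t; set X' := x t'; set Y := y t; set Y' := y t' => hY hX.
have -> : s * X + (1 - s) * Y - (s * X' + (1 - s) * Y') =
  s * (X - X') + (1 - s) * (Y - Y') by ring.
apply: le_trans (ler_normD _ _) _; rewrite !normrM (ger0_norm s0).
rewrite [`|1 - s|]ger0_norm ?subr_ge0 //.
have -> : e = s * e + (1 - s) * e by ring.
by apply: lerD; apply: ler_wpM2l => //; rewrite subr_ge0.
Qed.

Lemma ptclosed_equi (d : R -> R) : ptclosed (equi d).
Proof.
move=> G u PG Gd Gu e t t' e0 tt'.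
apply: (ler_cvg PG (Y := cst e) (X := fun w => `|w t - w t'|)).
- by apply: cvg_norm; apply: cvgB; exact: Gu.
- exact: cvg_cst.
- by apply: filterS Gd => w; exact.
Qed.

Lemma convex_bigcap I (D : set I) (P : I -> set func) :
  (forall i, convex_set (P i)) -> convex_set (\bigcap_(i in D) P i).
Proof. by move=> cP x y t xP yP t01 i Di; apply: cP; [exact: xP|exact: yP|]. Qed.

Lemma ptclosed_bigcap I (D : set I) (P : I -> set func) :
  (forall i, ptclosed (P i)) -> ptclosed (\bigcap_(i in D) P i).
Proof.
move=> cP G u PG GP Gu i Di; apply: cP Gu => //.
by apply: filterS GP => w; exact.
Qed.

Definition pinned (d : R -> R) (lo hi : R -> R) : set func :=
  equi d `&` \bigcap_(t in [set: R]) [set w | lo t <= w t <= hi t].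

Lemma convex_pinned d lo hi : convex_set (pinned d lo hi).
Proof.
apply: convex_setI; first exact: convex_equi.
apply: convex_bigcap => t x y r /= /andP[? ?] /andP[? ?] /andP[? ?].
by apply/andP; split; nra.
Qed.

Lemma ptclosed_pinned d lo hi : ptclosed (pinned d lo hi).
Proof.
apply: ptclosedI; first exact: ptclosed_equi.
apply: ptclosed_bigcap => t G u PG Gh Gu; apply/andP; split.
  apply: (ler_cvg PG (X := cst (lo t)) (Y := fun w => w t)).
  - exact: cvg_cst.
  - exact: Gu.
  - by apply: filterS Gh => w /andP[].
apply: (ler_cvg PG (Y := cst (hi t)) (X := fun w => w t)).
- exact: Gu.
- exact: cvg_cst.
- by apply: filterS Gh => w /andP[].
Qed.

(** The bound of the minimum by the norm is split into linear inequalities between two values, each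
    visibly convex and closed under pointwise convergence. *)
Definition cone (a b c : R) : set func :=
  [set w | forall t s, a <= t <= b -> c * w s <= w t].

Lemma convex_cone a b c : convex_set (cone a b c).
Proof.
move=> x y r cx cy /andP[r0 r1] t s /[dup] /(cx _ s) hx /(cy _ s) hy.
have : r * (c * x s) <= r * x t by exact: ler_wpM2l.
have : (1 - r) * (c * y s) <= (1 - r) * y t.
  by apply: ler_wpM2l; rewrite ?subr_ge0.
lra.
Qed.

Lemma ptclosed_cone a b c : ptclosed (cone a b c).
Proof.
move=> G u PG Gh Gu t s ts.
apply: (ler_cvg PG (X := fun w => c * w s) (Y := fun w => w t)).
- by apply: cvgM; [exact: cvg_cst|exact: Gu].
- exact: Gu.
- by apply: filterS Gh => w; exact.
Qed.
End Closedness.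

(** * Systems of operators in a cone *)

Section ConeSystem.
Variables (R : realType) (T1 T2 : (R -> R) -> (R -> R) -> R -> R).
Variables (a b c rho1 rho2 R1 R2 M : R) (d : R -> R).
Local Notation func := (R -> R).

Hypothesis ab : a <= b.
Hypothesis c01 : 0 < c <= 1.
Hypothesis (rho1_gt0 : 0 < rho1) (rho2_gt0 : 0 < rho2) (R2_gt0 : 0 < R2).
Hypothesis R1E : R1 = Num.max (rho1 / c) rho2.
Hypothesis d_gt0 : forall e : R, 0 < e -> 0 < d e.
Hypothesis T_equi : forall u v : func, continuous u -> continuous v ->
  equi d (T1 u v) /\ equi d (T2 u v).
Hypothesis T1_bound : forall u v : func, continuous u -> continuous v ->
  forall t : R, 0 <= T1 u v t <= M.
Hypothesis T1_cone : forall u v : func, continuous u -> continuous v ->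
  cone a b c (T1 u v).
Hypothesis T_cvg : forall (G : set_system (func * func))
    (U V : func * func -> func) (u v : func),
  Filter G -> continuous u -> continuous v ->
  (\forall z \near G, continuous (U z) /\ continuous (V z)) ->
  ucvg G U u -> ucvg G V v ->
  ucvg G (fun z => T1 (U z) (V z)) (T1 u v) /\
  ucvg G (fun z => T2 (U z) (V z)) (T2 u v).
Hypothesis T1_lower : forall u v : func, continuous u -> continuous v ->
  (forall t, a <= t <= b -> rho1 <= u t <= rho1 / c) ->
  (forall t, - R2 <= v t <= R2) ->
  forall t : R, a <= t <= b -> rho1 <= T1 u v t.
Hypothesis T1_upper : forall u v : func, continuous u -> continuous v ->
  (forall t, 0 <= u t <= rho2) -> (forall t, - R2 <= v t <= R2) ->
  forall t : R, T1 u v t <= rho2.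
Hypothesis T2_bound : forall u v : func, continuous u -> continuous v ->
  (forall t, 0 <= u t <= R1) -> (forall t, - R2 <= v t <= R2) ->
  forall t : R, - R2 <= T2 u v t <= R2.

Local Notation mn := (min_on `[a, b]%classic).
Local Notation mx := (max_on (@unitI R)).

Let ab0 : `[a, b]%classic !=set0.
Proof. by exists a; rewrite /= in_itv /= lexx. Qed.

Let I0 : @unitI R !=set0.
Proof. by exists 0; rewrite /unitI /= in_itv /= lexx ler01. Qed.

Let mem_ab t : `[a, b]%classic t -> a <= t <= b.
Proof. by rewrite /= in_itv. Qed.

Let ab_mem t : a <= t <= b -> `[a, b]%classic t.
Proof. by rewrite /= in_itv. Qed.

Lemma add_min_cvg (G : set_system (func * func)) U (u : func) : Filter G ->
  (forall t, 0 <= u t) -> ucvg G U u ->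
  ucvg G (fun z t => U z t + Num.max 0 (rho1 - mn (U z)))
    (fun t => u t + Num.max 0 (rho1 - mn u)).
Proof.
move=> FG u0 Uu e e0.
have e2 : 0 < e / 2 by rewrite divr_gt0.
have mU : (fun z => Num.max 0 (rho1 - mn (U z))) @ G --> Num.max 0 (rho1 - mn u).
  apply: cvg_maxr; first exact: cvg_cst.
  by apply: cvgB; [exact: cvg_cst|exact: (min_on_cvg _ ab0 u0)].
near=> z.
have h1 : forall t, `|U z t - u t| <= e / 2 by near: z; exact: Uu.
have : `|Num.max 0 (rho1 - mn u) - Num.max 0 (rho1 - mn (U z))| <= e / 2.
  by near: z; move/cvgrPdist_le : mU; exact.
move=> h2 t; have := h1 t; move: h2.
set A := Num.max _ _; set A' := Num.max _ _; rewrite !ler_norml; lra.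
Unshelve. all: by end_near. Qed.

Lemma continuous_shift (u : func) (k : R) : continuous u -> continuous (fun t => u t + k).
Proof. by move=> cu t; apply: cvgD; [exact: cu|exact: cvg_cst]. Qed.

Lemma continuous_scale (u : func) (k : R) : continuous u -> continuous (fun t => k * u t).
Proof. by move=> cu t; apply: cvgM; [exact: cvg_cst|exact: cu]. Qed.

(* Composing with [u |-> u + (rho1 - min u)^+], a retraction of the cone onto
   [min u >= rho1], makes the operator leave a convex set invariant. *)
Lemma compressive_case : rho1 / c < rho2 ->
  exists u v : func, [/\ continuous u, continuous v,
    (forall t, 0 <= u t <= rho2) /\ (forall t, - R2 <= v t <= R2),
    (forall t, a <= t <= b -> rho1 <= u t)
  & (forall t, T1 u v t = u t) /\ (forall t, T2 u v t = v t)].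
Proof.
move=> rho12; have /andP[c0 c1] := c01.
have R1rho2 : R1 = rho2 by rewrite R1E; apply/max_idPr/ltW.
pose P := pinned d (fun=> 0) (fun=> rho2) `&` cone a b c.
pose Q := pinned d (fun=> - R2) (fun=> R2).
pose ret (u : func) t := u t + Num.max 0 (rho1 - mn u).
have Pc u : P u -> continuous u by move=> [[du _] _]; exact: equi_continuous du.
have Qc u : Q u -> continuous u by move=> [du _]; exact: equi_continuous du.
have P0 u : P u -> forall t, 0 <= u t.
  by move=> [[_ uB] _] t; have /andP[] := uB t I.
have QR u : Q u -> forall t, - R2 <= u t <= R2 by move=> [_ uB] t; exact: uB.
have rc u : P u -> continuous (ret u) by move=> /Pc; exact: continuous_shift.
have ret_bnd u : P u -> forall t, 0 <= ret u t <= rho2.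
  move=> Pu t; rewrite /ret; have u0 := P0 _ Pu t.
  have [[_ /(_ t I) /andP[_ ub]] uc] := Pu.
  have h : c * u t <= mn u.
    by apply: min_on_ge => // s /mem_ab; exact: uc.
  case: (leP 0 (rho1 - mn u)) => hm; last by rewrite addr0 u0 ub.
  (* For a minimum [m <= rho1] the shifted function is at most [m / c + rho1 - m], which is at most
     [rho1 / c < rho2] since [c <= 1]. *)
  have : u t <= mn u / c by rewrite ler_pdivlMr // mulrC.
  have : mn u * (c^-1 - 1) <= rho1 * (c^-1 - 1).
    by apply: ler_wpM2r; [rewrite subr_ge0 invf_ge1|lra].
  lra.
have [u [v [Pu Qv Eu Ev]]] : exists u v,
    [/\ P u, Q v, T1 (ret u) v = u & T2 (ret u) v = v].
  apply: (@pair_fixpoint R d (Num.max rho2 R2)) => //.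
  - exists (fun=> 0); split; first split.
    + by move=> e t t' e0 _; rewrite subrr normr0 ltW.
    + by move=> t _ /=; rewrite lexx ltW.
    + by move=> t s _; rewrite mulr0.
  - exists (fun=> 0); split.
    + by move=> e t t' e0 _; rewrite subrr normr0 ltW.
    + by move=> t _ /=; rewrite oppr_le0 ltW.
  - by apply: convex_setI; [exact: convex_pinned|exact: convex_cone].
  - exact: convex_pinned.
  - by apply: ptclosedI; [exact: ptclosed_pinned|exact: ptclosed_cone].
  - exact: ptclosed_pinned.
  - move=> w [Pw|Qw]; split.
    + by case: Pw => -[].
    + move=> t; have w0 := P0 _ Pw t; have [[_ /(_ t I) /andP[_ ub]] _] := Pw.
      by rewrite ger0_norm // le_max ub.
    + by case: Qw.
    + by move=> t; have := QR _ Qw t; rewrite -ler_norml le_max => ->; rewrite orbT.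
  - move=> u v Pu Qv; have [cu cv] := (rc _ Pu, Qc _ Qv).
    have [e1 e2] := T_equi cu cv.
    split; first split; first split => //.
    + move=> t _ /=; have /andP[-> _] := T1_bound cu cv t.
      by rewrite (T1_upper cu cv (ret_bnd _ Pu) (QR _ Qv)).
    + exact: T1_cone.
    + split => // t _; apply: (T2_bound cu cv _ (QR _ Qv)).
      by rewrite R1rho2; exact: ret_bnd.
  - move=> G u v PG GPQ Pu Qv Gu Gv.
    have [h1 h2] : ucvg G (fun z => T1 (ret z.1) z.2) (T1 (ret u) v) /\
        ucvg G (fun z => T2 (ret z.1) z.2) (T2 (ret u) v).
      apply: T_cvg; [exact: rc|exact: Qc| | |exact: Gv].
      + by apply: filterS GPQ => z [/rc ? /Qc].
      + by apply: add_min_cvg Gu; exact: P0.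
    by split; apply: ucvg_ptcvg.
have cu := rc _ Pu; have cv := Qc _ Qv.
have u0 := P0 _ Pu.
(* Otherwise [ret u] lies between [rho1] and [rho1 / c] on [[a, b]], so [T1_lower] bounds
   [u = T1 (ret u) v] below by [rho1] there. Hence the retraction was inactive. *)
have m1 : rho1 <= mn u.
  rewrite leNgt; apply/negP => hm.
  have rE t : ret u t = u t + (rho1 - mn u).
    by rewrite /ret (max_idPr _) // subr_ge0 ltW.
  have mle t : a <= t <= b -> mn u <= u t.
    by move=> /ab_mem tab; apply: (min_on_le (B := 0)).
  suff : rho1 <= mn u by lra.
  apply: min_on_ge => // t /mem_ab tab; rewrite -Eu.
  apply: (T1_lower cu cv) => // [s sab|]; last exact: QR.
  have := mle _ sab; have := ret_bnd _ Pu s; rewrite rE.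
  have [_ uc] := Pu.
  have h : c * u s <= mn u.
    by apply: min_on_ge => // s' /mem_ab; exact: uc.
  have : u s <= mn u / c by rewrite ler_pdivlMr // mulrC.
  have : mn u * (c^-1 - 1) <= rho1 * (c^-1 - 1).
    by apply: ler_wpM2r; [rewrite subr_ge0 invf_ge1|lra].
  lra.
have rE : ret u = u.
  by apply/funext => t; rewrite /ret (max_idPl _) ?addr0 // subr_le0.
rewrite rE in Eu Ev.
exists u, v; split => //.
- exact: Pc.
- by split; [move=> t; rewrite -rE; exact: ret_bnd|exact: QR].
- by move=> t /ab_mem tab; apply: le_trans m1 _; apply: (min_on_le (B := 0)).
- by rewrite Eu Ev.
Qed.

(** The value at [a] serves as the normalisation: it is linear, so [1 <= w a <= 2] is a convex
    condition, and in the cone it dominates [c] times every other value, whence [2 / c]. *)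
Local Notation lo1 := (fun t : R => if t == a then 1 else 0 : R).
Local Notation hi2 := (fun t : R => if t == a then 2 else 2 / c).

(* In polar coordinates [w |-> (w / w a, w a - 1)] on the convex set
   [1 <= w a <= 2], the radius being the position of the second coordinate
   between the two boundaries, the radial component of the operator is
   inverted. *)
Let radius (w : func) := (1 - (w a - 1)) * (rho2 / mx w) + (w a - 1) * (rho1 / mn w).
Let polar (w : func) : func := fun t => radius w * w t.
Let drift (w v : func) := radius w * mx w - mx (T1 (polar w) v).
(** [T1] may vanish, so it has no direction of its own. The added constant makes the value at [a]
    bounded below and is 0 once the drift is 0. *)
Let push (w v : func) (t : R) := T1 (polar w) v t + Num.max 0 (drift w v).
(** The drift is positive when the operator lowers the maximum, and adding it then moves the point
    outwards: this is the reversal. *)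
Let tau' (w v : func) := Num.max 0 (Num.min 1 (w a - 1 + drift w v)).
Let inverted (w v : func) (t : R) := (1 + tau' w v) / push w v a * push w v t.

(** The normalising factor in [inverted] is at most [2 / (c * rho2)], so the modulus has to be taken
    at [K * e]. The bound [K <= 1] lets [T2] keep the same modulus. *)
Let K := Num.min 1 (c * rho2 / 2).
Let P := pinned (fun e => d (K * e)) lo1 hi2 `&` cone a b c.
Let Q := pinned (fun e => d (K * e)) (fun=> - R2) (fun=> R2).

Let a_ab : a <= a <= b. Proof. by rewrite lexx. Qed.

Let c_gt0 : 0 < c. Proof. by have /andP[] := c01. Qed.
Let c_le1 : c <= 1. Proof. by have /andP[] := c01. Qed.

Let K_gt0 : 0 < K.
Proof. by rewrite lt_min ltr01 divr_gt0 ?mulr_gt0. Qed.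

Let dK_gt0 e : 0 < e -> 0 < d (K * e).
Proof. by move=> e0; rewrite d_gt0 // mulr_gt0. Qed.

Let Pc u : P u -> continuous u.
Proof. by move=> [[du _] _]; exact: equi_continuous du. Qed.

Let Qc u : Q u -> continuous u.
Proof. by move=> [du _]; exact: equi_continuous du. Qed.

Let QR u : Q u -> forall t : R, - R2 <= u t <= R2.
Proof. by move=> [_ uB] t; exact: uB. Qed.

Let P_a w : P w -> 1 <= w a <= 2.
Proof. by move=> [[_ wB] _]; have := wB a I; rewrite /= eqxx. Qed.

Let P_ge0 w : P w -> forall t : R, 0 <= w t.
Proof.
by move=> [[_ wB] _] t; have /andP[+ _] := wB t I; case: ifP => // _; lra.
Qed.

Let P_le w : P w -> forall t : R, w t <= 2 / c.
Proof.
move=> Pw t; have [_ wc] := Pw; have := wc a t a_ab.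
by rewrite ler_pdivlMr // mulrC => /le_trans; apply; have /andP[] := P_a Pw.
Qed.

Let P_mx w : P w -> forall t : R, w t <= mx w.
Proof.
move=> Pw t; have [[dw _] _] := Pw; rewrite -(equi_clamp t dK_gt0 dw).
apply: max_on_ge (fun s _ => P_le Pw s) _.
by rewrite /unitI /= in_itv /= clamp_itv.
Qed.

Let P_mn w : P w -> forall t : R, a <= t <= b -> mn w <= w t.
Proof. by move=> Pw t /ab_mem; apply: min_on_le (fun s _ => P_ge0 Pw s). Qed.

Let P_mn_mx w : P w -> [/\ 1 <= mx w, c * mx w <= mn w, 0 < mn w & mn w <= mx w].
Proof.
move=> Pw; have := P_mx Pw a; have := P_mn Pw a_ab; have /andP[w1 _] := P_a Pw.
move=> h1 h2; have h3 : 1 <= mx w by lra.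
have h4 : c * mx w <= mn w.
  apply: min_on_ge => // t /mem_ab tab; rewrite mulrC -ler_pdivlMr //.
  apply: max_on_le => // s _; rewrite ler_pdivlMr // mulrC.
  by have [_ wc] := Pw; exact: wc.
split => //; last lra.
by apply: lt_le_trans h4; rewrite mulr_gt0 //; lra.
Qed.

Hypothesis rho21 : rho2 < rho1.

Let radius_bnd w : P w -> rho2 / mx w <= radius w <= rho1 / mn w.
Proof.
move=> Pw; have [n1 cn m0 mlen] := P_mn_mx Pw; have /andP[w1 w2] := P_a Pw.
have n0 : 0 < mx w by lra.
have h : rho2 / mx w <= rho1 / mn w.
  rewrite ler_pdivrMr // mulrAC ler_pdivlMr //; apply: ler_pM => //; exact: ltW.
rewrite /radius; set X := rho2 / _ in h *; set Y := rho1 / _ in h *.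
by apply/andP; split; nra.
Qed.

Let radius_gt0 w : P w -> 0 < radius w.
Proof.
move=> Pw; have /andP[+ _] := radius_bnd Pw; apply: lt_le_trans.
by have [n1 _ _ _] := P_mn_mx Pw; rewrite divr_gt0 //; lra.
Qed.

Let polar_c w : P w -> continuous (polar w).
Proof. by move=> /Pc cw; exact: continuous_scale. Qed.

(** At the outer end of a ray the minimum is [rho1], so by the cone the maximum is at most
    [rho1 / c]. *)
Let polar_bnd w : P w -> forall t : R, 0 <= polar w t <= R1.
Proof.
move=> Pw t; have r0 := ltW (radius_gt0 Pw); rewrite /polar.
apply/andP; split; first by apply: mulr_ge0 => //; exact: P_ge0.
have [n1 cn m0 mlen] := P_mn_mx Pw.
have /andP[_ r2] := radius_bnd Pw.
rewrite R1E le_max; apply/orP; left.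
apply: (@le_trans _ _ (rho1 / mn w * mx w)).
  by apply: ler_pM => //; [exact: P_ge0|exact: P_mx].
rewrite mulrAC ler_pdivrMr // mulrAC ler_pdivlMr // -mulrA.
by apply: ler_wpM2l; [exact: ltW|rewrite mulrC].
Qed.

Let T1_mx w v : P w -> Q v -> forall t : R, T1 (polar w) v t <= mx (T1 (polar w) v).
Proof.
move=> Pw Qv t; have [cu cv] := (polar_c Pw, Qc Qv).
have [du _] := T_equi cu cv; rewrite -(equi_clamp t d_gt0 du).
apply: (@max_on_ge _ _ _ M); last by rewrite /unitI /= in_itv /= clamp_itv.
by move=> s _; have /andP[] := T1_bound cu cv s.
Qed.

(** The maximum of [T1 (polar w) v] plus the positive part of the drift is at least the maximum of
    [polar w], hence at least [rho2]. The cone passes this on to the point [a] at the cost of the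
    factor [c]. *)
Let push_ge w v : P w -> Q v -> c * rho2 <= push w v a.
Proof.
move=> Pw Qv; have [cu cv] := (polar_c Pw, Qc Qv).
have [n1 _ _ _] := P_mn_mx Pw.
have /andP[r1 _] := radius_bnd Pw.
have h1 : rho2 <= radius w * mx w by rewrite -ler_pdivrMr //; lra.
have h2 : c * mx (T1 (polar w) v) <= T1 (polar w) v a.
  rewrite mulrC -ler_pdivlMr //; apply: max_on_le => // s _.
  by rewrite ler_pdivlMr // mulrC; exact: (T1_cone cu cv).
have h3 : drift w v <= Num.max 0 (drift w v) by rewrite le_max lexx orbT.
have h4 : 0 <= Num.max 0 (drift w v) by rewrite le_max lexx.
rewrite /push; move: h3 h4; rewrite {1}/drift; set D := Num.max _ _ => h3 h4.
have : c * rho2 <= c * (radius w * mx w) by apply: ler_wpM2l => //; exact: ltW.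
have : c * (radius w * mx w - mx (T1 (polar w) v)) <= c * D.
  by apply: ler_wpM2l => //; exact: ltW.
have : c * D <= D by rewrite ler_piMl.
lra.
Qed.

Let push_gt0 w v : P w -> Q v -> 0 < push w v a.
Proof. by move=> Pw Qv; apply: lt_le_trans (push_ge Pw Qv); rewrite mulr_gt0. Qed.

Let tau_bnd w v : 0 <= tau' w v <= 1.
Proof. by rewrite /tau' le_max lexx /= ge_max ler01 ge_min lexx. Qed.

Let inverted_P w v : P w -> Q v -> P (inverted w v).
Proof.
move=> Pw Qv; have [cu cv] := (polar_c Pw, Qc Qv).
have p0 := push_gt0 Pw Qv.
have /andP[t0 t1] := tau_bnd w v.
have k0 : 0 <= (1 + tau' w v) / push w v a.
  by apply: divr_ge0; [rewrite addr_ge0|exact: ltW].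
have M0 : 0 <= Num.max 0 (drift w v) by rewrite le_max lexx.
have pge t : 0 <= push w v t.
  by apply: addr_ge0 => //; have /andP[] := T1_bound cu cv t.
have pcone : cone a b c (push w v).
  move=> t s tab; have := T1_cone cu cv s tab; rewrite /push.
  have : c * Num.max 0 (drift w v) <= Num.max 0 (drift w v) by rewrite ler_piMl.
  lra.
have ia : inverted w v a = 1 + tau' w v by rewrite /inverted divfK // gt_eqF.
have icone : cone a b c (inverted w v).
  by move=> t s tab; rewrite /inverted mulrCA ler_wpM2l // pcone.
split => //; split.
  move=> e t t' e0 tt'; rewrite /inverted -mulrBr normrM ger0_norm //.
  have -> : push w v t - push w v t' = T1 (polar w) v t - T1 (polar w) v t'.
    by rewrite /push; ring.
  have [du _] := T_equi cu cv.
  have h1 := du (K * e) t t' (mulr_gt0 K_gt0 e0) tt'.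
  have h2 : (1 + tau' w v) / push w v a <= 2 / (c * rho2).
    apply: ler_pM; rewrite ?invr_ge0 ?(ltW p0) //; try lra.
    by rewrite lef_pV2 ?push_ge // posrE // mulr_gt0.
  apply: le_trans (ler_pM _ _ h2 h1) _ => //.
  have : K <= c * rho2 / 2 by rewrite ge_min lexx orbT.
  have cr : 0 < c * rho2 by rewrite mulr_gt0.
  rewrite mulrA => hK; rewrite ler_piMl ?(ltW e0) //.
  by rewrite mulrAC ler_pdivrMr // mul1r mulrC -ler_pdivlMr.
move=> t _ /=; case: eqP => [->|_]; first by rewrite ia; apply/andP; split; lra.
rewrite mulr_ge0 //= ler_pdivlMr // mulrC.
by apply: le_trans (icone a t a_ab) _; rewrite ia; lra.
Qed.

Let ucvg_drift (G : set_system (func * func)) w v : ProperFilter G ->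
  (\forall z \near G, P z.1 /\ Q z.2) -> P w -> Q v ->
  ucvg G fst w -> ucvg G snd v ->
  [/\ ucvg G (fun z => T1 (polar z.1) z.2) (T1 (polar w) v),
      ucvg G (fun z => T2 (polar z.1) z.2) (T2 (polar w) v) &
      (fun z => drift z.1 z.2) @ G --> drift w v].
Proof.
move=> PG GPQ Pw Qv Gw Gv.
have [cu cv] := (polar_c Pw, Qc Qv).
have [n1 cn m0 mlen] := P_mn_mx Pw.
have mxG : (fun z : func * func => mx z.1) @ G --> mx w.
  exact: (max_on_cvg _ I0 (P_le Pw)).
have mnG : (fun z : func * func => mn z.1) @ G --> mn w.
  exact: (min_on_cvg _ ab0 (P_ge0 Pw)).
have aG : (fun z : func * func => z.1 a) @ G --> w a by exact: (ucvg_ptcvg _ Gw).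
have rG : (fun z : func * func => radius z.1) @ G --> radius w.
  apply: cvgD; apply: cvgM.
  - apply: cvgB; first exact: cvg_cst.
    by apply: cvgB => //; exact: cvg_cst.
  - apply: cvgM; first exact: cvg_cst.
    by apply: cvgV => //; rewrite gt_eqF //; lra.
  - by apply: cvgB => //; exact: cvg_cst.
  - apply: cvgM; first exact: cvg_cst.
    by apply: cvgV => //; rewrite gt_eqF.
have pG : ucvg G (fun z => polar z.1) (polar w).
  apply: (@ucvgZ _ _ _ (fun z => radius z.1) fst _ _ (2 / c)) => // t.
  by rewrite ger0_norm ?P_ge0 ?P_le.
have [h1 h2] : ucvg G (fun z => T1 (polar z.1) z.2) (T1 (polar w) v) /\
    ucvg G (fun z => T2 (polar z.1) z.2) (T2 (polar w) v).
  by apply: T_cvg => //; apply: filterS GPQ => z [/polar_c ? /Qc].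
split => //; apply: cvgB; first exact: cvgM.
apply: (max_on_cvg _ I0 _ h1) => t.
by have /andP[_ h] := T1_bound cu cv t; exact: h.
Qed.

Lemma expansive_case :
  exists u v : func, [/\ continuous u, continuous v,
    (forall t : R, 0 <= u t <= R1) /\ (forall t : R, - R2 <= v t <= R2),
    cone a b c u /\ rho2 <= mx u /\ mn u <= rho1
  & (forall t : R, T1 u v t = u t) /\ (forall t : R, T2 u v t = v t)].
Proof.
have [w [v [Pw Qv Ew Ev]]] : exists w v,
    [/\ P w, Q v, inverted w v = w & T2 (polar w) v = v].
  apply: (@pair_fixpoint R (fun e => d (K * e)) (Num.max (2 / c) R2)) => //.
  - exists (fun=> 1); split; first split.
    + by move=> e t t' e0 _; rewrite subrr normr0 ltW.
    + move=> t _ /=; case: ifP => _; first by rewrite lexx ler1n.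
      by rewrite ler01 /= ler_pdivlMr // mul1r (le_trans c_le1) // ler1n.
    + by move=> t s _; rewrite mulr1.
  - exists (fun=> 0); split.
    + by move=> e t t' e0 _; rewrite subrr normr0 ltW.
    + by move=> t _ /=; rewrite oppr_le0 ltW.
  - by apply: convex_setI; [exact: convex_pinned|exact: convex_cone].
  - exact: convex_pinned.
  - by apply: ptclosedI; [exact: ptclosed_pinned|exact: ptclosed_cone].
  - exact: ptclosed_pinned.
  - move=> w [Pw|Qw]; split.
    + by case: Pw => -[].
    + by move=> t; rewrite ger0_norm ?P_ge0 // le_max P_le.
    + by case: Qw.
    + by move=> t; have := QR Qw t; rewrite -ler_norml le_max => ->; rewrite orbT.
  - move=> w v Pw Qv; have [cu cv] := (polar_c Pw, Qc Qv).
    split; first exact: inverted_P.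
    have [_ e2] := T_equi cu cv; split => [e t t' e0 tt'|t _].
      apply: le_trans (e2 _ t t' (mulr_gt0 K_gt0 e0) tt') _.
      by rewrite ler_piMl ?ge_min ?lexx // ltW.
    exact: (T2_bound cu cv (polar_bnd Pw) (QR Qv)).
  - move=> G w v PG GPQ Pw Qv Gw Gv.
    have [h1 h2 h3] := ucvg_drift PG GPQ Pw Qv Gw Gv.
    split; last exact: ucvg_ptcvg.
    have aG : (fun z : func * func => z.1 a) @ G --> w a by exact: (ucvg_ptcvg _ Gw).
    have pG : ptcvg G (fun z => push z.1 z.2) (push w v).
      move=> t; apply: cvgD; first exact: (ucvg_ptcvg _ h1).
      by apply: cvg_maxr => //; exact: cvg_cst.
    have tG : (fun z => tau' z.1 z.2) @ G --> tau' w v.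
      have minE (x : R) : Num.min 1 x = - Num.max (-1) (- x).
        by rewrite -oppr_min opprK.
      rewrite /tau' minE; under eq_fun do rewrite minE.
      apply: cvg_maxr; first exact: cvg_cst.
      apply: cvgN; apply: cvg_maxr; first exact: cvg_cst.
      by apply: cvgN; apply: cvgD => //; apply: cvgB => //; exact: cvg_cst.
    move=> t; apply: cvgM; last exact: pG.
    apply: cvgM; first by apply: cvgD => //; exact: cvg_cst.
    by apply: cvgV; [rewrite gt_eqF // push_gt0|exact: pG].
have [cu cv] := (polar_c Pw, Qc Qv).
have [n1 cn m0 mlen] := P_mn_mx Pw; have /andP[w1 w2] := P_a Pw.
have p0 := push_gt0 Pw Qv; have r0 := radius_gt0 Pw.
have wa : w a = 1 + tau' w v.
  by rewrite -{1}Ew /inverted divfK // gt_eqF.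
(* At a fixed point [push w v] is a multiple of [w]. Comparing maxima will identify the factor with
   [radius w]. *)
pose mu := push w v a / w a.
have mu0 : 0 < mu by rewrite divr_gt0 //; lra.
have pw t : push w v t = mu * w t.
  by rewrite -[in RHS]Ew /inverted /mu -wa; field; rewrite !gt_eqF //; lra.
have mxscale k x : 0 < k -> (forall t, x t = k * w t) -> mx x = k * mx w.
  move=> k0 xw; apply/eqP; rewrite eq_le; apply/andP; split.
    by apply: max_on_le => // t _; rewrite xw ler_wpM2l ?P_mx // ltW.
  rewrite mulrC -ler_pdivlMr //; apply: max_on_le => // t tI.
  rewrite ler_pdivlMr // mulrC -xw; apply: (max_on_ge (B := k * mx w)) => // s _.
  by rewrite xw ler_wpM2l ?P_mx // ltW.
have mxpush : mx (push w v) = mx (T1 (polar w) v) + Num.max 0 (drift w v).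
  apply/eqP; rewrite eq_le; apply/andP; split.
    by apply: max_on_le => // t _; rewrite /push lerD2r T1_mx.
  rewrite -lerBrDr; apply: max_on_le => // t tI; rewrite lerBrDr.
  apply: (@max_on_ge _ _ (push w v) (mu * mx w)) => // s _.
  by rewrite pw ler_wpM2l ?P_mx // ltW.
have mupush := mxscale mu (push w v) mu0 pw.
have mlow k : 0 < k -> (forall t, a <= t <= b -> k <= radius w * w t) ->
    k <= radius w * mn w.
  move=> k0 kw; rewrite mulrC -ler_pdivrMr //; apply: min_on_ge => // t /mem_ab tab.
  by rewrite ler_pdivrMr // mulrC; exact: kw.
(* A nonzero drift leaves [w a - 1] fixed only through the clamping in [tau']. A negative one forces
   [w a = 1], where [polar w] has maximum [rho2] and [T1_upper] makes the drift nonnegative. *)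
have drift0 : drift w v = 0.
  apply/eqP/negP => /negP; rewrite neq_lt => /orP[dn|dp].
    have tau0 : w a = 1.
      move: wa; rewrite /tau'; case: (leP 1 (w a - 1 + drift w v)) => ?.
        by rewrite (max_idPr ler01); lra.
      by case: (leP 0 (w a - 1 + drift w v)) => ?; lra.
    have rE : radius w = rho2 / mx w.
      by rewrite /radius tau0 subrr subr0 mul1r mul0r addr0.
    have hn : radius w * mx w = rho2 by rewrite rE divfK // gt_eqF //; lra.
    have : mx (T1 (polar w) v) <= rho2.
      apply: max_on_le => // t _; apply: (T1_upper cu cv) => // [s|]; last exact: QR.
      have /andP[-> _] := polar_bnd Pw s; rewrite /= -hn /polar.
      by apply: ler_wpM2l; [exact: ltW|exact: P_mx].
    move: dn; rewrite /drift hn; lra.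
  (* A positive drift forces [w a = 2], where [polar w] has minimum [rho1]. But then [polar w] is
     [T1 (polar w) v] plus the drift, and [T1_lower] puts its minimum strictly above [rho1]. *)
  have maxd : Num.max 0 (drift w v) = drift w v by apply/max_idPr/ltW.
  have tau1 : w a = 2.
    move: wa; rewrite /tau'; case: (leP 1 (w a - 1 + drift w v)) => ?.
      by rewrite (max_idPr ler01); lra.
    by case: (leP 0 (w a - 1 + drift w v)) => ?; lra.
  have rE : radius w = rho1 / mn w.
    by rewrite /radius tau1 (_ : 2 - 1 = 1 :> R) ?subrr ?mul0r ?add0r ?mul1r //; ring.
  have hm : radius w * mn w = rho1 by rewrite rE divfK // gt_eqF.
  have mur : mu = radius w.
    apply: (@mulIf _ (mx w)); first by rewrite gt_eqF //; lra.
    by rewrite -mupush mxpush maxd /drift; ring.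
  have : rho1 + drift w v <= radius w * mn w.
    apply: mlow; first by rewrite addr_gt0.
    move=> t tab; rewrite -mur -pw /push maxd lerD2r.
    apply: (T1_lower cu cv) => // [s sab|]; last exact: QR.
    rewrite /polar -{1}hm ler_wpM2l ?P_mn ?(ltW r0) //=.
    apply: (@le_trans _ _ (radius w * mx w)); first by rewrite ler_wpM2l ?P_mx ?(ltW r0).
    by rewrite ler_pdivlMr // -hm -mulrA ler_wpM2l ?(ltW r0) // mulrC.
  by rewrite hm; lra.
have mur : mu = radius w.
  apply: (@mulIf _ (mx w)); first by rewrite gt_eqF //; lra.
  rewrite -mupush mxpush drift0 maxxx addr0.
  by move: drift0; rewrite /drift => /eqP; rewrite subr_eq0 => /eqP.
have fixu t : T1 (polar w) v t = polar w t.
  by have := pw t; rewrite /push drift0 maxxx addr0 mur.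
have /andP[r1 r2] := radius_bnd Pw.
exists (polar w), v; split => //.
- by split; [exact: polar_bnd|exact: QR].
- split.
    move=> t s tab; rewrite /polar mulrCA ler_wpM2l ?(ltW r0) //.
    by case: Pw => _; exact.
  split.
    by rewrite (mxscale _ _ r0 (fun=> erefl)) -ler_pdivrMr //; lra.
  apply: (@le_trans _ _ (radius w * mn w)); last by rewrite -ler_pdivlMr.
  rewrite mulrC -ler_pdivrMr //; apply: min_on_ge => // t tab.
  rewrite ler_pdivrMr // mulrC; apply: (min_on_le (B := 0)) => // s _.
  by have /andP[] := polar_bnd Pw s.
- by split => [//|t]; rewrite Ev.
Qed.
End ConeSystem.

(** * Hammerstein operators *)

Section CompactContinuity.
Variable R : realType.

Lemma heine (T : pseudoMetricType R) (A : set T) (h : T -> R) :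
  compact A -> {within A, continuous h} ->
  forall e : R, 0 < e -> exists2 d : R, 0 < d &
    forall x y, A x -> A y -> ball x d y -> `|h x - h y| <= e.
Proof.
move=> /compact_near_coveringP/near_covering_withinP cA /subspace_continuousP ch' e e0.
have ch x : A x -> h y @[y --> within A (nbhs x)] --> h x by exact: ch'.
(* Near-covering compactness: what holds near each point for all small [d] holds on all of [A] for a
   common [d]. *)
have [|d /= d0 dP] := cA _ (0 : R)^'+
  (fun d x => forall y, A y -> ball x d y -> `|h x - h y| <= e) _.
  move=> x Ax; have e2 : 0 < e / 2 by rewrite divr_gt0.
  have /cvgrPdist_le/(_ _ e2) := ch x Ax.
  rewrite near_withinE => /nbhs_ballP[r /= r0 rP].
  have r2 : 0 < r / 2 by rewrite divr_gt0.
  near=> x' d => /= Ax' y Ay x'y.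
  have xx' : ball x (r / 2) x' by near: x'; exact: nbhsx_ballx.
  have dr : d <= r / 2 by near: d; exact: nbhs_right_le.
  have xy : ball x r y.
    rewrite [r]splitr; apply: ball_triangle xx' _.
    exact: le_ball x'y.
  have rr : r / 2 <= r by lra.
  have := rP _ (le_ball rr xx') Ax'; have := rP _ xy Ay.
  rewrite !ler_norml; lra.
exists (d / 2); first by rewrite divr_gt0.
move=> x y Ax Ay; apply: (dP (d / 2)) => //; last by rewrite divr_gt0.
by rewrite /ball_ /= sub0r normrN ger0_norm; lra.
Unshelve. all: by end_near. Qed.

Lemma compact_bnd (T : topologicalType) (A : set T) (h : T -> R) :
  compact A -> {within A, continuous h} -> exists M, forall x, A x -> `|h x| <= M.
Proof.
move=> cA ch; have /compact_bounded := continuous_compact ch cA.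
move=> [M [_ MP]]; exists (M + 1) => x Ax.
by apply: (MP (M + 1)); [rewrite ltrDl|exists x].
Qed.

Lemma continuous_comp_within (T U : topologicalType) (A : set U) (h : U -> R)
    (r : T -> U) :
  {within A, continuous h} -> continuous r -> (forall x, A (r x)) ->
  continuous (h \o r).
Proof.
move=> /subspace_continuousP ch cr Ar x W hW.
have : nbhs (r x) [set y | A y -> W (h y)] by exact: (ch (r x) (Ar x)).
move=> /cr hr; apply: (@filterS _ (nbhs x) _ _ _ _ hr) => y Wy.
exact: (Wy (Ar y)).
Qed.

Lemma continuous_clamp (lo hi : R) : continuous (clamp lo hi).
Proof.
move=> t; apply/cvgrPdist_le => e e0; near=> t'.
apply: le_trans (clamp_lip _ _ _ _) _; near: t'.
exact: (@cvgr_dist_le _ _ _ (nbhs t) _ id).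
Unshelve. all: by end_near. Qed.

End CompactContinuity.

Section Integrals.
Variable R : realType.
Local Notation mu := (@lebesgue_measure R).
Implicit Types phi psi : R -> R.

Lemma integrable_itv phi (x y : R) : continuous phi ->
  mu.-integrable `[x, y]%classic (EFin \o phi).
Proof.
move=> cphi; apply: continuous_compact_integrable; first exact: segment_compact.
exact: continuous_subspaceT.
Qed.

Lemma measure_unitI : mu (@unitI R) = 1%E.
Proof. by rewrite /unitI lebesgue_measure_itv /= lte_fin ltr01 oppr0 adde0. Qed.

Lemma measurable_unitI : measurable (@unitI R).
Proof. exact: measurable_itv. Qed.
#[local] Hint Resolve measurable_unitI : core.

Lemma unitIP s : @unitI R s -> 0 <= s <= 1.
Proof. by rewrite /unitI /= in_itv. Qed.

Lemma int_le phi psi : continuous phi -> continuous psi ->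
  (forall s, 0 <= s <= 1 -> phi s <= psi s) ->
  \int[mu]_(s in unitI) phi s <= \int[mu]_(s in unitI) psi s.
Proof.
move=> cphi cpsi le; apply: le_Rintegral => //; try exact: integrable_itv.
Qed.

Lemma int_cst k : \int[mu]_(s in (@unitI R)) k = k.
Proof. by rewrite Rintegral_cst // [X in fine X]measure_unitI mulr1. Qed.

Lemma int_bnd phi k : continuous phi -> (forall s, 0 <= s <= 1 -> `|phi s| <= k) ->
  `|\int[mu]_(s in unitI) phi s| <= k.
Proof.
move=> cphi le; rewrite -[k]int_cst.
apply: le_trans (le_normr_Rintegral _ _) _ => //; first exact: integrable_itv.
apply: int_le => //; last exact: cst_continuous.
by move=> s; apply: cvg_norm; exact: cphi.
Qed.

Lemma int_dist phi psi k : continuous phi -> continuous psi ->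
  (forall s, 0 <= s <= 1 -> `|phi s - psi s| <= k) ->
  `|\int[mu]_(s in unitI) phi s - \int[mu]_(s in unitI) psi s| <= k.
Proof.
move=> cphi cpsi le; rewrite -RintegralB //; try exact: integrable_itv.
by apply: int_bnd => // s; apply: cvgB; [exact: cphi|exact: cpsi].
Qed.

Lemma int_subset phi a b : 0 <= a -> b <= 1 -> continuous phi ->
  (forall s, 0 <= s <= 1 -> 0 <= phi s) ->
  \int[mu]_(s in `[a, b]%classic) phi s <= \int[mu]_(s in unitI) phi s.
Proof.
move=> a0 b1 cphi phi0.
have ia := integrable_itv a b cphi; have iI := integrable_itv 0 1 cphi.
apply: fine_le; [exact: integrable_fin_num|exact: integrable_fin_num|].
apply: ge0_subset_integral => //.
- by case/integrableP : iI.
- by move=> s; rewrite /unitI /= !in_itv /= => /andP[? ?]; apply/andP; split; lra.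
Qed.
End Integrals.

(** * The integral operator for globally bounded, uniformly continuous data *)

Section Hammerstein.
Variable R : realType.
Local Notation mu := (@lebesgue_measure R).
Local Notation func := (R -> R).
Variables (k : R -> R -> R) (h : R -> R -> R -> R) (Mk Mh : R).
Hypothesis k_cont : forall t, continuous (k t).
Hypothesis k_uc : forall e : R, 0 < e -> exists2 d : R, 0 < d & forall t t' s,
  `|clamp 0 1 t - clamp 0 1 t'| <= d -> `|k t s - k t' s| <= e.
Hypothesis h_uc : forall e : R, 0 < e -> exists2 d : R, 0 < d & forall s s' u u' v v',
  `|s - s'| <= d -> `|u - u'| <= d -> `|v - v'| <= d ->
  `|h s u v - h s' u' v'| <= e.
Hypothesis k_bnd : forall t s, `|k t s| <= Mk.
Hypothesis h_bnd : forall s u v, `|h s u v| <= Mh.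

Definition hammerstein (u v : func) (t : R) : R :=
  \int[mu]_(s in unitI) (k t s * h s (u s) (v s)).

Let Mk0 : 0 <= Mk. Proof. by apply: le_trans (k_bnd 0 0). Qed.
Let Mh0 : 0 <= Mh. Proof. by apply: le_trans (h_bnd 0 0 0). Qed.

Lemma superposition_continuous u v : continuous u -> continuous v ->
  continuous (fun s => h s (u s) (v s)).
Proof.
move=> cu cv s; apply/cvgrPdist_le => e e0.
have [d d0 dP] := h_uc e0; near=> s'; apply: dP; near: s'.
- exact: (@cvgr_dist_le _ _ _ (nbhs s) _ id).
- exact: cvgr_dist_le (cu s) _ d0.
- exact: cvgr_dist_le (cv s) _ d0.
Unshelve. all: by end_near. Qed.

Lemma integrand_continuous u v t : continuous u -> continuous v ->
  continuous (fun s => k t s * h s (u s) (v s)).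
Proof.
by move=> cu cv s; apply: cvgM; [exact: k_cont|exact: superposition_continuous].
Qed.

Lemma ham_bnd u v t : continuous u -> continuous v -> `|hammerstein u v t| <= Mk * Mh.
Proof.
move=> cu cv; apply: int_bnd; first exact: integrand_continuous.
by move=> s _; rewrite normrM ler_pM.
Qed.

Lemma ham_equi e : 0 < e -> exists2 d, 0 < d & forall u v t t',
  continuous u -> continuous v -> `|clamp 0 1 t - clamp 0 1 t'| <= d ->
  `|hammerstein u v t - hammerstein u v t'| <= e.
Proof.
move=> e0; have e1 : 0 < e / (Mh + 1) by rewrite divr_gt0 // ltr_wpDl.
have [d d0 dP] := k_uc e1; exists d => // u v t t' cu cv tt'.
apply: int_dist; try exact: integrand_continuous.
move=> s _; rewrite -mulrBl normrM.
apply: le_trans (ler_pM _ _ (dP _ _ s tt') (h_bnd _ _ _)) _ => //.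
by rewrite mulrAC ler_pdivrMr ?ltr_wpDl // ler_pM2l // lerDl.
Qed.

Lemma ham_cvg (T : Type) (G : set_system T) (U V : T -> func) (u v : func) :
  Filter G -> continuous u -> continuous v ->
  (\forall z \near G, continuous (U z) /\ continuous (V z)) ->
  ucvg G U u -> ucvg G V v -> ucvg G (fun z => hammerstein (U z) (V z)) (hammerstein u v).
Proof.
move=> FG cu cv UV Uu Vv e e0.
have e1 : 0 < e / (Mk + 1) by rewrite divr_gt0 // ltr_wpDl.
have [d d0 dP] := h_uc e1; near=> z.
have [cU cV] : continuous (U z) /\ continuous (V z) by near: z.
have hU : forall t, `|U z t - u t| <= d by near: z; exact: Uu.
have hV : forall t, `|V z t - v t| <= d by near: z; exact: Vv.
move=> t; apply: int_dist; try exact: integrand_continuous.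
move=> s _; rewrite -mulrBr normrM.
apply: le_trans (ler_pM _ _ (k_bnd t s) (dP s s _ _ _ _ _ (hU s) (hV s))) _ => //.
  by rewrite subrr normr0 ltW.
by rewrite mulrC mulrAC ler_pdivrMr ?ltr_wpDl // ler_pM2l // lerDl.
Unshelve. all: by end_near. Qed.

End Hammerstein.


(** * Truncation of the kernels and nonlinearities *)

Section ClampedData.
Variable R : realType.
Local Notation mu := (@lebesgue_measure R).
Local Notation cl := (@clamp R 0 1).

Definition clamp2 (k : R -> R -> R) (t s : R) := k (cl t) (cl s).

(** All arguments are forced into a compact box, which gives bounds and uniform continuity on the
    whole space. The solutions found later take values in the box, where nothing has changed. *)
Definition clamp3 (R1 R2 : R) (f : R -> R -> R -> R) (s u v : R) :=
  f (cl s) (clamp 0 R1 u) (clamp (- R2) R2 v).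

Lemma clamp01_itv t : 0 <= cl t <= 1.
Proof. by rewrite clamp_itv. Qed.

Lemma clamp01_mem t : cl t \in `[0, 1]%R.
Proof. by rewrite in_itv /= clamp01_itv. Qed.

Lemma clamp01_unitI t : unitI (cl t).
Proof. exact: clamp01_mem. Qed.

Lemma continuous_pair (T U V : topologicalType) (x : T -> U) (y : T -> V) :
  continuous x -> continuous y -> continuous (fun t => (x t, y t)).
Proof. by move=> cx cy t; apply: cvg_pair; [exact: cx|exact: cy]. Qed.

Lemma clamp2_continuous k t :
  {within unitI `*` unitI, continuous (fun p : R * R => k p.1 p.2)} ->
  continuous (clamp2 k t).
Proof.
move=> ck; apply: (continuous_comp_within (r := fun s => (cl t, cl s)) ck).
  apply: continuous_pair; [exact: cst_continuous|exact: continuous_clamp].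
by move=> s; split; exact: clamp01_unitI.
Qed.

Let compact_unitI : compact (@unitI R).
Proof. exact: segment_compact. Qed.

Lemma clamp2_uc k :
  {within unitI `*` unitI, continuous (fun p : R * R => k p.1 p.2)} ->
  forall e : R, 0 < e -> exists2 d : R, 0 < d & forall t t' s,
  `|cl t - cl t'| <= d -> `|clamp2 k t s - clamp2 k t' s| <= e.
Proof.
move=> ck e e0.
have [d d0 dP] := heine (compact_setX compact_unitI compact_unitI) ck e0.
exists (d / 2); first by rewrite divr_gt0.
move=> t t' s tt'; apply: (dP (cl t, cl s) (cl t', cl s)).
- by split; exact: clamp01_unitI.
- by split; exact: clamp01_unitI.
- split; last exact: ballxx.
  by rewrite -ball_normE /ball_ /=; lra.
Qed.

Lemma clamp2_bnd k :
  {within unitI `*` unitI, continuous (fun p : R * R => k p.1 p.2)} ->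
  exists M, forall t s, `|clamp2 k t s| <= M.
Proof.
move=> ck; have [M MP] := compact_bnd (compact_setX compact_unitI compact_unitI) ck.
by exists M => t s; apply: (MP (cl t, cl s)); split; exact: clamp01_unitI.
Qed.

Section Nonlinearity.
Variables (R1 R2 : R) (f : R -> R -> R -> R).
Hypotheses (R1_ge0 : 0 <= R1) (R2_ge0 : 0 <= R2).
Hypothesis cf : {within unitI `*` `[0, +oo[%classic `*` setT,
     continuous (fun p : R * R * R => f p.1.1 p.1.2 p.2)}.

Let A : set (R * R * R) := unitI `*` `[0, R1]%classic `*` `[- R2, R2]%classic.

Let cA : compact A.
Proof. by apply: compact_setX; [apply: compact_setX|]; exact: segment_compact. Qed.

Let cfA : {within A, continuous (fun p : R * R * R => f p.1.1 p.1.2 p.2)}.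
Proof.
apply: continuous_subspaceW cf => -[[s u] v] [[/= s01 u0] _]; split => //; split => //.
by move: u0; rewrite /= !in_itv /= andbT => /andP[].
Qed.

Let A_clamp s u v : A (cl s, clamp 0 R1 u, clamp (- R2) R2 v).
Proof.
split; first split; first exact: clamp01_unitI.
  by rewrite /= in_itv /= clamp_itv.
by rewrite /= in_itv /= clamp_itv // ge0_cp.
Qed.

Lemma clamp3_uc : forall e : R, 0 < e -> exists2 d : R, 0 < d & forall s s' u u' v v',
  `|s - s'| <= d -> `|u - u'| <= d -> `|v - v'| <= d ->
  `|clamp3 R1 R2 f s u v - clamp3 R1 R2 f s' u' v'| <= e.
Proof.
move=> e e0; have [d d0 dP] := heine cA cfA e0.
exists (d / 2); first by rewrite divr_gt0.
have dl lo hi x y : `|x - y| <= d / 2 -> `|clamp lo hi x - clamp lo hi y| < d.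
  by move=> xy; have := clamp_lip lo hi x y; lra.
move=> s s' u u' v v' ss uu vv.
apply: (dP (cl s, clamp 0 R1 u, clamp (- R2) R2 v)
           (cl s', clamp 0 R1 u', clamp (- R2) R2 v')) => //.
by split; [split|]; apply: dl.
Qed.

Lemma clamp3_bnd : exists M, forall s u v, `|clamp3 R1 R2 f s u v| <= M.
Proof.
have [M MP] := compact_bnd cA cfA.
by exists M => s u v; apply: (MP (cl s, clamp 0 R1 u, clamp (- R2) R2 v)).
Qed.
End Nonlinearity.

Lemma clamp_CI w : CI w -> continuous (fun s => w (cl s)).
Proof.
move=> cw; apply: (continuous_comp_within (r := cl) cw).
  exact: continuous_clamp.
exact: clamp01_unitI.
Qed.

Lemma int_le_max_on k w t :
  {within unitI `*` unitI, continuous (fun p : R * R => k p.1 p.2)} -> CI w ->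
  \int[mu]_(s in unitI) (clamp2 k t s * w (cl s)) <=
  max_on unitI (fun t => \int[mu]_(s in unitI) (k t s * w s)).
Proof.
move=> ck cw.
have eqI x : \int[mu]_(s in unitI) (clamp2 k x s * w (cl s)) =
    \int[mu]_(s in unitI) (k (cl x) s * w s).
  apply: eq_Rintegral => s; rewrite inE => /unitIP s01.
  by rewrite /clamp2 (clamp_id s01).
(* The supremum in [max_on] dominates the integrals only once these are known to be bounded, here by
   [Mk * Mw]. *)
have [Mk kM] := clamp2_bnd ck.
have [Mw wM] := compact_bnd compact_unitI cw.
rewrite eqI; apply: (max_on_ge (B := Mk * Mw)); last exact: clamp01_unitI.
move=> x /unitIP x01; rewrite -[x](clamp_id x01) -eqI.
apply: le_trans (ler_norm _) _; apply: int_bnd => [s|s _].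
  by apply: cvgM; [exact: clamp2_continuous|exact: clamp_CI].
by rewrite normrM ler_pM // wM //; exact: clamp01_unitI.
Qed.

Lemma min_on_le_int k w a b t : 0 <= a -> b <= 1 ->
  (forall t s, t \in `[0, 1]%R -> s \in `[0, 1]%R -> 0 <= k t s) ->
  (forall s, s \in `[0, 1]%R -> 0 <= w s) ->
  a <= t <= b ->
  min_on `[a, b]%classic (fun t => \int[mu]_(s in `[a, b]%classic) (k t s * w s)) <=
  \int[mu]_(s in `[a, b]%classic) (clamp2 k t s * w (cl s)).
Proof.
move=> a0 b1 k0 w0 tab.
have sub x : a <= x <= b -> x \in `[0, 1]%R.
  by move=> /andP[ax xb]; rewrite in_itv /= (le_trans a0) //= (le_trans xb).
have -> : \int[mu]_(s in `[a, b]%classic) (clamp2 k t s * w (cl s)) =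
    \int[mu]_(s in `[a, b]%classic) (k t s * w s).
  apply: eq_Rintegral => s; rewrite inE /= in_itv /= => /sub s01.
  have t01 := sub _ tab.
  by rewrite /clamp2 (clamp_id s01) (clamp_id t01).
apply: (min_on_le (B := 0)); last by rewrite /= in_itv.
move=> x; rewrite /= in_itv /= => /sub x01; apply: Rintegral_ge0 => s.
by rewrite /= in_itv /= => /sub s01; rewrite mulr_ge0 ?k0 ?w0.
Qed.
End ClampedData.

(** * The truncated operators satisfy the abstract conditions *)

Theorem theorem3p2 (R : realType) (k1 k2 : R -> R -> R) (f g : R -> R -> R -> R)
    (a b : R) (Phi1 Phi2 : R -> R) (c1 c2 : R) (rho1 rho2 R2 : R)
    (fl fu gu : R -> R) :
  let mu := @lebesgue_measure R in
  let R1 := Num.max (rho1 / c1) rho2 in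
  (* the kernels *)
  {within unitI `*` unitI, continuous (fun p : R * R => k1 p.1 p.2)} ->
  {within unitI `*` unitI, continuous (fun p : R * R => k2 p.1 p.2)} ->
  (forall t s, t \in `[0, 1]%R -> s \in `[0, 1]%R -> 0 <= k1 t s) ->
  (forall t s, t \in `[0, 1]%R -> s \in `[0, 1]%R -> 0 <= k2 t s) ->
  0 <= a -> a <= b -> b <= 1 ->
  (forall s, s \in `[0, 1]%R -> 0 <= Phi1 s) ->
  L1I Phi1 ->
  0 < c1 <= 1 ->
  (forall t s, t \in `[0, 1]%R -> s \in `[0, 1]%R -> k1 t s <= Phi1 s) ->
  (forall t s, t \in `[a, b]%R -> s \in `[0, 1]%R -> c1 * Phi1 s <= k1 t s) ->
  (forall s, s \in `[0, 1]%R -> 0 <= Phi2 s) ->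
  L1I Phi2 ->
  0 < c2 <= 1 ->
  (forall t s, t \in `[0, 1]%R -> s \in `[0, 1]%R ->
     c2 * Phi2 s <= k2 t s <= Phi2 s) ->
  (* the nonlinearities *)
  {within unitI `*` `[0, +oo[%classic `*` setT,
     continuous (fun p : R * R * R => f p.1.1 p.1.2 p.2)} ->
  (forall t u v, t \in `[0, 1]%R -> 0 <= u -> 0 <= f t u v) ->
  {within unitI `*` `[0, +oo[%classic `*` setT,
     continuous (fun p : R * R * R => g p.1.1 p.1.2 p.2)} ->
  (* Case A or Case B *)
  0 < rho1 -> 0 < rho2 -> 0 < R2 ->
  (rho1 / c1 < rho2 \/ rho2 < rho1) ->
  (* (i) *)
  CI fl ->
  (forall t, t \in `[0, 1]%R -> 0 <= fl t) ->
  (forall t u v, t \in `[a, b]%R -> u \in `[rho1, rho1 / c1]%R ->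
     v \in `[- R2, R2]%R -> fl t <= f t u v) ->
  rho1 <= min_on `[a, b]%classic
            (fun t => \int[mu]_(s in `[a, b]%classic) (k1 t s * fl s)) ->
  (* (ii) *)
  CI fu ->
  (forall t, t \in `[0, 1]%R -> 0 <= fu t) ->
  (forall t u v, t \in `[0, 1]%R -> u \in `[0, rho2]%R ->
     v \in `[- R2, R2]%R -> f t u v <= fu t) ->
  max_on unitI (fun t => \int[mu]_(s in unitI) (k1 t s * fu s)) <= rho2 ->
  (* (iii) *)
  CI gu ->
  (forall t, t \in `[0, 1]%R -> 0 <= gu t) ->
  (forall t u v, t \in `[0, 1]%R -> u \in `[0, R1]%R ->
     v \in `[- R2, R2]%R -> `|g t u v| <= gu t) ->
  max_on unitI (fun t => \int[mu]_(s in unitI) (k2 t s * gu s)) <= R2 ->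
  exists u v : R -> R,
    [/\ K1 a b c1 u /\ CI v,
        (forall t, t \in `[0, 1]%R ->
           u t = \int[mu]_(s in unitI) (k1 t s * f s (u s) (v s)) /\
           v t = \int[mu]_(s in unitI) (k2 t s * g s (u s) (v s))),
        (* (u, v) <> (0, 0) *)
        ~ (forall t, t \in `[0, 1]%R -> u t = 0 /\ v t = 0),
        normI v <= R2
      & (rho1 / c1 < rho2 ->
           rho1 <= min_on `[a, b]%classic u /\ normI u <= rho2) /\
        (rho2 < rho1 ->
           rho2 <= normI u /\ min_on `[a, b]%classic u <= rho1)].
Proof.
move=> mu R1 ck1 ck2 k1_ge0 k2_ge0 a0 ab b1 Phi1_ge0 _ c01 k1_le k1_ge _ _ _ _
  cf f_ge0 cg rho1_gt0 rho2_gt0 R2_gt0 cases cfl fl_ge0 fl_le int_fl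
  cfu fu_ge0 fu_ge int_fu cgu gu_ge0 gu_ge int_gu.
have R1_gt0 : 0 < R1 by rewrite lt_max rho2_gt0 orbT.
have [R1_ge0 R2_ge0] : 0 <= R1 /\ 0 <= R2 by rewrite !ltW.
have /andP[c1_gt0 c1_le1] := c01.
pose T1 := hammerstein (clamp2 k1) (clamp3 R1 R2 f).
pose T2 := hammerstein (clamp2 k2) (clamp3 R1 R2 g).
have k1c t := @clamp2_continuous _ _ t ck1.
have k2c t := @clamp2_continuous _ _ t ck2.
have k1u := clamp2_uc ck1; have k2u := clamp2_uc ck2.
have [M1 k1M] := clamp2_bnd ck1; have [M2 k2M] := clamp2_bnd ck2.
have fuc := clamp3_uc R1_ge0 R2_ge0 cf; have guc := clamp3_uc R1_ge0 R2_ge0 cg.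
have [Mf fM] := clamp3_bnd R1_ge0 R2_ge0 cf.
have [Mg gM] := clamp3_bnd R1_ge0 R2_ge0 cg.
have k1p t s : 0 <= clamp2 k1 t s by apply: k1_ge0; exact: clamp01_mem.
have k2p t s : 0 <= clamp2 k2 t s by apply: k2_ge0; exact: clamp01_mem.
have fp s u v : 0 <= clamp3 R1 R2 f s u v.
  apply: f_ge0; first exact: clamp01_mem.
  by have /andP[] := clamp_itv u R1_ge0.
have fE s u v : 0 <= u <= R1 -> - R2 <= v <= R2 ->
    clamp3 R1 R2 f s u v = f (clamp 0 1 s) u v.
  by move=> u01 v01; rewrite /clamp3 (clamp_id u01) (clamp_id v01).
have gE s u v : 0 <= u <= R1 -> - R2 <= v <= R2 ->
    clamp3 R1 R2 g s u v = g (clamp 0 1 s) u v.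
  by move=> u01 v01; rewrite /clamp3 (clamp_id u01) (clamp_id v01).
have rho2R1 : rho2 <= R1 by rewrite le_max lexx orbT.
have rho1R1 : rho1 / c1 <= R1 by rewrite le_max lexx.
pose modulus e d := 0 < e -> 0 < d /\ forall (u v : R -> R) t t',
    continuous u -> continuous v -> `|clamp 0 1 t - clamp 0 1 t'| <= d ->
    `|T1 u v t - T1 u v t'| <= e /\ `|T2 u v t - T2 u v t'| <= e.
have [d dP] : {d : R -> R & forall e, modulus e (d e)}.
  apply: choice => e; rewrite /modulus; have [e0|e0] := ltP 0 e; last by exists 0.
  have [d1 d10 d1P] := ham_equi k1c k1u fuc fM e0.
  have [d2 d20 d2P] := ham_equi k2c k2u guc gM e0.
  exists (Num.min d1 d2) => _; rewrite lt_min d10 d20; split => // u v t t' cu cv.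
  by rewrite le_min => /andP[? ?]; split; [exact: d1P|exact: d2P].
have d_gt0 e : 0 < e -> 0 < d e by move=> /dP[].
have T_equi (u v : R -> R) : continuous u -> continuous v ->
    equi d (T1 u v) /\ equi d (T2 u v).
  move=> cu cv; split => e t t' e0 tt'; have [_ H] := dP e e0.
    by have [] := H _ _ _ _ cu cv tt'.
  by have [] := H _ _ _ _ cu cv tt'.
have T1_bound (u v : R -> R) : continuous u -> continuous v ->
    forall t, 0 <= T1 u v t <= M1 * Mf.
  move=> cu cv t; apply/andP; split.
    by apply: Rintegral_ge0 => s _; rewrite mulr_ge0.
  by apply: le_trans (ler_norm _) _; apply: ham_bnd.
have ic1 u v t : continuous u -> continuous v ->
    continuous (fun s => clamp2 k1 t s * clamp3 R1 R2 f s (u s) (v s)).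
  by move=> cu cv; exact: integrand_continuous.
have T1_cone (u v : R -> R) : continuous u -> continuous v -> cone a b c1 (T1 u v).
  move=> cu cv t s /andP[at_ tb].
  have -> : c1 * T1 u v s = \int[mu]_(x in unitI)
      (c1 * (clamp2 k1 s x * clamp3 R1 R2 f x (u x) (v x))).
    by apply/esym/RintegralZl; [exact: measurable_itv|exact/integrable_itv/ic1].
  apply: int_le => [x||x x01]; [apply: cvgM; [exact: cvg_cst|exact: ic1]|exact: ic1|].
  (* The kernels compare through [Phi1]: [c1 * k1 s x <= c1 * Phi1 x <= k1 t x] for [t] in
     [[a, b]]. *)
  rewrite mulrA ler_wpM2r //.
  have t01 : 0 <= t <= 1 by apply/andP; split; lra.
  apply: (@le_trans _ _ (c1 * Phi1 (clamp 0 1 x))).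
    by rewrite ler_wpM2l ?(ltW c1_gt0) // k1_le // clamp01_mem.
  by rewrite /clamp2 (clamp_id t01) k1_ge ?clamp01_mem // in_itv /= at_ tb.
have T_cvg : forall (G : set_system ((R -> R) * (R -> R)))
    (U V : (R -> R) * (R -> R) -> R -> R) (u v : R -> R),
    Filter G -> continuous u -> continuous v ->
    (\forall z \near G, continuous (U z) /\ continuous (V z)) ->
    ucvg G U u -> ucvg G V v ->
    ucvg G (fun z => T1 (U z) (V z)) (T1 u v) /\
    ucvg G (fun z => T2 (U z) (V z)) (T2 u v).
  by move=> G U V u v FG cu cv cUV Uu Vv; split;
    [exact: (ham_cvg k1c fuc k1M) | exact: (ham_cvg k2c guc k2M)].
have T1_lower (u v : R -> R) : continuous u -> continuous v ->
    (forall t, a <= t <= b -> rho1 <= u t <= rho1 / c1) ->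
    (forall t, - R2 <= v t <= R2) -> forall t, a <= t <= b -> rho1 <= T1 u v t.
  move=> cu cv ub vb t tab; apply: le_trans int_fl _.
  apply: le_trans (min_on_le_int a0 b1 k1_ge0 fl_ge0 tab) _.
  (* Hypothesis (i) integrates over [[a, b]] only, where the bounds on [u] are available. The rest
     of the integrand is nonnegative. *)
  apply: le_trans (int_subset a0 b1 (ic1 _ _ t cu cv) _); last first.
    by move=> s _; rewrite mulr_ge0.
  apply: le_Rintegral => //.
  - apply: integrable_itv => s.
    by apply: cvgM; [exact: k1c|exact: clamp_CI].
  - exact/integrable_itv/ic1.
  - move=> s; rewrite /= in_itv /= => sab; rewrite ler_wpM2l //.
    have s01 : 0 <= s <= 1 by move: sab => /andP[? ?]; apply/andP; split; lra.
    have /andP[u1 u2] := ub _ sab.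
    rewrite fE ?vb //; last by rewrite (le_trans _ u1) ?(ltW rho1_gt0) // (le_trans u2).
    by rewrite (clamp_id s01) fl_le // in_itv /= ?u1 ?vb.
have T1_upper (u v : R -> R) : continuous u -> continuous v ->
    (forall t, 0 <= u t <= rho2) -> (forall t, - R2 <= v t <= R2) ->
    forall t, T1 u v t <= rho2.
  move=> cu cv ub vb t; apply: le_trans int_fu.
  apply: le_trans (int_le_max_on t ck1 cfu).
  apply: int_le; [exact: ic1| |move=> s s01].
    by move=> s; apply: cvgM; [exact: k1c|exact: clamp_CI].
  rewrite ler_wpM2l //; have /andP[u1 u2] := ub s.
  rewrite fE ?vb ?u1 ?(le_trans u2) //.
  by rewrite fu_ge ?clamp01_mem // in_itv /= ?ub ?vb.
have T2_bound (u v : R -> R) : continuous u -> continuous v ->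
    (forall t, 0 <= u t <= R1) -> (forall t, - R2 <= v t <= R2) ->
    forall t, - R2 <= T2 u v t <= R2.
  move=> cu cv ub vb t; rewrite -ler_norml; apply: le_trans int_gu.
  apply: le_trans (int_le_max_on t ck2 cgu).
  have ic : continuous (fun s => clamp2 k2 t s * clamp3 R1 R2 g s (u s) (v s)).
    exact: integrand_continuous.
  apply: le_trans (le_normr_Rintegral _ _) _.
  - exact: measurable_itv.
  - exact: integrable_itv.
  apply: int_le => [s||s s01].
  - by apply: cvg_norm; exact: ic.
  - by move=> s; apply: cvgM; [exact: k2c|exact: clamp_CI].
  - rewrite normrM (ger0_norm (k2p _ _)) ler_wpM2l // gE //.
    by rewrite gu_ge ?clamp01_mem // in_itv /= ?ub ?vb.
(* Within the bounds [R1] and [R2] the truncation is invisible, so fixed points solve the original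
   system. *)
have final (u v : R -> R) : continuous u -> continuous v ->
    (forall t, 0 <= u t <= R1) -> (forall t, - R2 <= v t <= R2) ->
    (forall t, T1 u v t = u t) -> (forall t, T2 u v t = v t) ->
    [/\ K1 a b c1 u /\ CI v,
        (forall t, t \in `[0, 1]%R ->
           u t = \int[mu]_(s in unitI) (k1 t s * f s (u s) (v s)) /\
           v t = \int[mu]_(s in unitI) (k2 t s * g s (u s) (v s)))
      & normI v <= R2].
  move=> cu cv ub vb Eu Ev.
  have I0 : @unitI R !=set0 by exists (clamp 0 1 0); exact: clamp01_unitI.
  split.
  - split; last exact: continuous_subspaceT.
    split; first exact: continuous_subspaceT.
      by move=> t _; have /andP[] := ub t.
    apply: min_on_ge => [|t]; first by exists a; rewrite /= in_itv /= lexx.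
    rewrite /= in_itv /= => tab; rewrite mulrC -ler_pdivlMr //.
    apply: max_on_le => // s _; have /andP[u0 _] := ub s.
    rewrite ger0_norm // ler_pdivlMr // mulrC -!Eu.
    exact: T1_cone.
  - move=> t t01; rewrite -Eu -Ev.
    split; apply: eq_Rintegral => s; rewrite inE => /unitIP s01.
      by rewrite fE ?ub ?vb // /clamp2 (clamp_id s01) clamp_id.
    by rewrite gE ?ub ?vb // /clamp2 (clamp_id s01) clamp_id.
  - by apply: max_on_le => // t _; rewrite ler_norml.
have a01 : a \in `[0, 1]%R by rewrite in_itv /= a0 (le_trans ab).
have [rho12|rho21] := cases.
- have [u [v [cu cv [ub vb] ul [Eu Ev]]]] := compressive_case ab c01 rho2_gt0
    R2_gt0 erefl d_gt0 T_equi T1_bound T1_cone T_cvg T1_lower T1_upper T2_bound rho12.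
  have ubR t : 0 <= u t <= R1.
    by have /andP[-> ut] := ub t; rewrite /= (le_trans ut).
  have [H1 H2 H3] := final u v cu cv ubR vb Eu Ev.
  exists u, v; split => //.
    by move=> /(_ a a01)[ua _]; have := ul a; rewrite ua lexx ab => /(_ isT); lra.
  split => [_|rho21].
    split.
      apply: min_on_ge => [|t]; first by exists a; rewrite /= in_itv /= lexx.
      by rewrite /= in_itv; exact: ul.
    apply: max_on_le => [|t _]; first by exists a; exact: a01.
    by have /andP[u0 u1] := ub t; rewrite ger0_norm.
  (* The two cases exclude each other because [c1 <= 1]. *)
  exfalso; have : rho1 <= rho1 / c1 by rewrite ler_pdivlMr // ler_piMr // ltW.
  lra.
- have [u [v [cu cv [ub vb] [ucone [un um]] [Eu Ev]]]] := expansive_case ab c01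
    rho1_gt0 rho2_gt0 R2_gt0 erefl d_gt0 T_equi T1_bound T1_cone T_cvg T1_lower
    T1_upper T2_bound rho21.
  have [H1 H2 H3] := final u v cu cv ub vb Eu Ev.
  have I0 : @unitI R !=set0 by exists a; exact: a01.
  have un' : rho2 <= normI u.
    apply: le_trans un _; apply: max_on_le => // t tI.
    apply: (@le_trans _ _ `|u t|); first exact: ler_norm.
    apply: (@max_on_ge _ unitI (fun s => `|u s|) R1) => // s _.
    by have /andP[u0 u1] := ub s; rewrite ger0_norm.
  exists u, v; split => //.
    move=> uv0; suff : normI u <= 0 by lra.
    by apply: max_on_le => // t tI; have [-> _] := uv0 t tI; rewrite normr0.
  split => [rho12|_]; last by [].
  exfalso; have : rho1 <= rho1 / c1 by rewrite ler_pdivlMr // ler_piMr // ltW.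
  lra.
Qed.
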